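(* Let $\Omega\subset\mathbb{R}^d$ be a bounded domain with outward unit normal $\boldsymbol\nu_{\partial\Omega}$ and $\delta t_k>0$ a time step. Given the time-level data $(n^k,T^k,\mathbf u^k)$ and the $l$th iterate $(n^{k+1,l},T^{k+1,l})$, suppose the $(l+1)$th iterate $(n^{k+1,l+1},T^{k+1,l+1},\mathbf u^{k+1,l+1})$ (all sufficiently smooth, molar densities in $(0,1/b)$, temperatures positive) satisfies the decoupled linearized iteration $$\mathbf u_\star^{k,l}=\mathbf u^k-\frac{\delta t_k}{\rho^k}\big(n^k\nabla\mu^{k+1,l+1}+s^k\nabla T^{k+1,l}\big),$$ $$\frac{n^{k+1,l+1}-n^k}{\delta t_k}+\nabla\cdot(n^k\mathbf u_\star^{k,l})=0,$$ $$\rho^k\Big(\frac{\mathbf u^{k+1,l+1}-\mathbf u^k}{\delta t_k}+\mathbf u_\star^{k,l}\cdot\nabla\mathbf u^{k+1,l+1}\Big)=-n^k\nabla\mu^{k+1,l+1}+\gamma^k\nabla T^{k+1,l}+\nabla\cdot\big(\eta^kD(\mathbf u^{k+1,l+1})\big)+\nabla(\lambda^k\nabla\cdot\mathbf u^{k+1,l+1}),$$ $$\begin{aligned}\frac{\vartheta^{k+1,l+1}-\vartheta^k}{\delta t_k}+\nabla\cdot(\mathbf u_\star^{k,l}s^kT^{k+1,l})=\ &\nabla\cdot(\Theta^k\nabla T^{k+1,l+1})-\nabla\cdot\big((\nabla\cdot(\mathbf u_\star^{k,l}n^k))c^{k+1,l}\nabla n^{k+1,l+1}\big)\\&-\mu^{k+1,l+1}\nabla\cdot(\mathbf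 u_\star^{k,l}n^k)-\mathbf u_\star^{k,l}\cdot\gamma^k\nabla T^{k+1,l}+\eta^kD(\mathbf u^{k+1,l+1}):\nabla\mathbf u^{k+1,l+1}\\&+\lambda^k|\nabla\cdot\mathbf u^{k+1,l+1}|^2+\frac1{2\delta t_k}\rho^k\big(|\mathbf u^{k+1,l+1}-\mathbf u_\star^{k,l}|^2+|\mathbf u_\star^{k,l}-\mathbf u^k|^2\big),\end{aligned}$$ where $$\begin{aligned}\mu^{k+1,l+1}=\ &\mu_b^{\mathrm{convex}}(n^{k+1,l},T^{k+1,l})+\frac{\partial\mu_b^{\mathrm{convex}}}{\partial n}(n^{k+1,l},T^{k+1,l})\,(n^{k+1,l+1}-n^{k+1,l})\\&+\mu_b^{\mathrm{concave}}(n^k,T^{k+1,l})-\nabla\cdot\big(c(T^{k+1,l})\nabla n^{k+1,l+1}\big),\end{aligned}$$ $$\vartheta^{k+1,l+1}=\vartheta(n^{k+1,l+1},T^{k+1,l})+\frac{\partial\vartheta}{\partial T}(n^{k+1,l+1},T^{k+1,l})\,(T^{k+1,l+1}-T^{k+1,l}),$$ with the boundary conditions described in the context. Set $\mathcal E^k=\frac12\int_\Omega\rho^k|\mathbf u^k|^2d\mathbf x+\int_\Omega\vartheta^kd\mathbf x$ and $\mathcal E^{k+1,l+1}=\frac12\int_\Omega\rho^{k+1,l+1}|\mathbf u^{k+1,l+1}|^2d\mathbf x+\int_\Omega\vartheta^{k+1,l+1}d\mathbf x$. Then the first law of thermodynamics holds: $$\frac{\mathcal E^{k+1,l+1}-\mathcal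 E^k}{\delta t_k}=-\int_{\partial\Omega}\mathbf q^{k+1}_{\partial\Omega}\cdot\boldsymbol\nu_{\partial\Omega}\,d\mathbf s,$$ where $\mathbf q^{k+1}_{\partial\Omega}=-\Theta^k\nabla T^{k+1,l+1}|_{\partial\Omega}$ is the heat transfer flux between the system and its environment.
   Context: Constants: gas constant $R>0$, critical temperature $T_c>0$, critical pressure $P_c>0$, acentric factor $\omega$, molar weight $M_w>0$, reference values $T_0=298.15$ K, $P_0=1$ bar, $\vartheta_0=-2478.95687512$ J/mol, and heat capacity coefficients $\alpha_0,\dots,\alpha_3$. Put $T_r=T/T_c$, $\psi_p(T)=\sum_{i=0}^3\alpha_iT^i$, $$a(T)=0.45724\frac{R^2T_c^2}{P_c}\big[1+m(1-\sqrt{T_r})\big]^2,\qquad b=0.07780\frac{RT_c}{P_c},$$ where $m=0.37464+1.54226\omega-0.26992\omega^2$ if $\omega\le 0.49$ and $m=0.379642+1.485030\omega-0.164423\omega^2+0.016666\omega^3$ if $\omega>0.49$. Bulk (Peng-Robinson) Helmholtz free energy density: $f_b=f_b^{\mathrm{convex}}+f_b^{\mathrm{concave}}$, $f_b^{\mathrm{convex}}=f_b^{\mathrm{ideal}}+f_b^{\mathrm{repulsion}}$, $f_b^{\mathrm{concave}}=f_b^{\mathrm{attraction}}$, with $$f_b^{\mathrm{ideal}}=n\vartheta_0+n\sum_{i=0}^3\alpha_i\frac{T^{i+1}-T_0^{i+1}}{i+1}-nR(T-T_0)-nRT\ln\Big(\frac{P_0}{nRT}\Big)-nT\int_{T_0}^T\frac{\psi_p(\tau)}{\tau}d\tau,$$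 $$f_b^{\mathrm{repulsion}}=-nRT\ln(1-bn),\qquad f_b^{\mathrm{attraction}}=\frac{a(T)n}{2\sqrt2\,b}\ln\Big(\frac{1+(1-\sqrt2)bn}{1+(1+\sqrt2)bn}\Big).$$ $\mu_b^{\mathrm{convex}}=\partial f_b^{\mathrm{convex}}/\partial n$, $\mu_b^{\mathrm{concave}}=\partial f_b^{\mathrm{concave}}/\partial n$. Influence parameter: $c(T)=a(T)b^{2/3}[\beta_1(1-T_r)+\beta_2]$, $\beta_1=-\frac{10^{-16}}{1.2326+1.3757\omega}$, $\beta_2=\frac{10^{-16}}{0.9051+1.5410\omega}$; $c^{k+1,l}=c(T^{k+1,l})$. Definitions: $f=f_b+\frac12c|\nabla n|^2$; $\gamma=\partial f_b/\partial T+\frac12c'(T)|\nabla n|^2$; entropy density $s=-\gamma$; internal energy density $\vartheta=\vartheta(n,T)=f+Ts$ (with $\partial\vartheta/\partial T$ taken at fixed $n$, $\nabla n$); mass density $\rho=nM_w$, $\rho^{k+1,l+1}=n^{k+1,l+1}M_w$. A superscript $k$ on $\gamma,s,\vartheta,\rho,\eta,\lambda,\Theta$ means evaluation at $(n^k,T^k)$. Shear viscosity $\eta>0$, volumetric viscosity $\xi>\frac23\eta$, $\lambda=\xi-\frac23\eta$; $D(\mathbf u)=\nabla\mathbf u+\nabla\mathbf u^T$; heat diffusion coefficient $\Theta=\Theta(n,T)\ge0$; $\mathbf v\cdot\nabla\mathbf u=(\mathbf v\cdot\nabla)\mathbf u$. Boundary conditions: all velocities $\mathbf u^k$, $\mathbf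 u^{k+1,l+1}$ vanish on $\partial\Omega$ and all molar densities satisfy $\nabla n\cdot\boldsymbol\nu_{\partial\Omega}=0$ on $\partial\Omega$; in the definition of $\mathbf u_\star^{k,l}$ the normal derivatives of the chemical potential and temperature are taken to be zero on the boundary, and the convention is that $\mathbf u_\star^{k,l}=0$ on $\partial\Omega$. *)

(* Defs.v *)
From HB Require Import structures.
From mathcomp Require Import all_boot all_order all_algebra.
From mathcomp Require Import all_classical all_reals all_analysis.
Import Order.TTheory GRing.Theory Num.Theory.
Import numFieldNormedType.Exports.
Set Implicit Arguments.
Unset Strict Implicit.
Unset Printing Implicit Defensive.
Local Open Scope classical_set_scope.
Local Open Scope ring_scope.

(* The coordinate-generated sigma-algebra on row vectors, as the library does for
   tuples; it is the Borel sigma-algebra. *)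
Section rV_measurable.
Context {R : realType} {n : nat}.
Let coor (i : 'I_n) (x : 'rV[R]_n) : measurableTypeR R := x ord0 i.
Let m0 : g_sigma_preimage coor set0.
Proof. exact: sigma_algebra0. Qed.
Let mC A : g_sigma_preimage coor A -> g_sigma_preimage coor (~` A).
Proof. exact: sigma_algebraC. Qed.
Let mU (F : _^nat) : (forall i, g_sigma_preimage coor (F i)) ->
  g_sigma_preimage coor (\bigcup_i F i).
Proof. exact: sigma_algebra_bigcup. Qed.
HB.instance Definition _ := @isMeasurable.Build default_measure_display
  'rV[R]_n (g_sigma_preimage coor) m0 mC mU.

Lemma measurable_coor (i : 'I_n) :
  measurable_fun [set: 'rV[R]_n] (coor i).
Proof.
move=> _ Y mY; rewrite setTI; apply: sub_sigma_algebra => /=.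
rewrite -bigcup_seq/=; exists i => /=; first by rewrite mem_index_enum.
by exists Y => //; rewrite setTI.
Qed.

Lemma measurable_fun_coorP d (T : measurableType d) (f : T -> 'rV[R]_n) :
  (forall i, measurable_fun [set: T] (fun x => f x ord0 i : measurableTypeR R)) ->
  measurable_fun [set: T] f.
Proof.
move=> mf _ Y mY; rewrite setTI.
have : measurable_fun [set: T] f.
  apply: (@measurability _ _ _ _ _ _ (\big[setU/set0]_(i < n)
    preimage_set_system setT (coor i) measurable)) => //.
  move=> _ [B + <-]; rewrite -bigcup_seq => -[i _ [C mC' <-]].
  by rewrite !setTI; have := mf i measurableT _ mC'; rewrite setTI.
by move=> /(_ measurableT _ mY); rewrite setTI.
Qed.
End rV_measurable.


Definition consv {R : realType} {n} (p : measurableTypeR R * 'rV[R]_n) :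
    'rV[R]_n.+1 := row_mx (p.1 : R)%:M p.2.

Section lebesgue_rV.
Context {R : realType}.
Local Open Scope ereal_scope.

Lemma measurable_consv n : measurable_fun [set: _] (@consv R n).
Proof.
apply: measurable_fun_coorP => i.
case: (split_ordP (i : 'I_(1 + n))) => j -> .
  rewrite (_ : (fun _ => _) = fst); first exact: measurable_fst.
  apply/funext => p; apply: etrans (row_mxEl _ _ ord0 j) _.
  by rewrite mxE (ord1 j) mulr1n.
rewrite (_ : (fun _ => _) = (fun y : 'rV[R]_n => y ord0 j) \o snd).
  exact: (measurableT_comp (measurable_coor j) measurable_snd).
by apply/funext => p; exact: (row_mxEr _ _ ord0 j).
Qed.

Section step.
Variables (n : nat) (mu : {sigma_finite_measure set 'rV[R]_n -> \bar R}).

Definition lebesgue_succ : set 'rV[R]_n.+1 -> \bar R :=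
  pushforward (@lebesgue_measure R \x mu) (@consv R n).

Let succ0 : lebesgue_succ set0 = 0.
Proof. by rewrite /lebesgue_succ /pushforward preimage_set0 measure0. Qed.

Let succ_ge0 A : 0 <= lebesgue_succ A.
Proof. exact: (measure_ge0 (@lebesgue_measure R \x mu)). Qed.

Let succ_sigma_additive : semi_sigma_additive lebesgue_succ.
Proof.
move=> F mF tF mUF; rewrite /lebesgue_succ /pushforward preimage_bigcup.
apply: measure_semi_sigma_additive.
- by move=> k; rewrite -[X in measurable X]setTI; exact: measurable_consv.
- apply/trivIsetP => /= i j _ _ ij; rewrite -preimage_setI.
  by move/trivIsetP : tF => /(_ _ _ _ _ ij) ->//; rewrite preimage_set0.
- by rewrite -preimage_bigcup -[X in measurable X]setTI; exact: measurable_consv.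
Qed.

HB.instance Definition _ := isMeasure.Build _ _ _ lebesgue_succ
  succ0 succ_ge0 succ_sigma_additive.

Let succ_sigma_finite : sigma_finite setT lebesgue_succ.
Proof.
have /sigma_finiteP[F [FT ndF Foo]] := sigma_finiteT (@lebesgue_measure R).
have /sigma_finiteP[G [GT ndG Goo]] := sigma_finiteT mu.
pose unc (x : 'rV[R]_n.+1) : (measurableTypeR R * 'rV[R]_n)%type :=
  (x ord0 ord0, rsubmx (x : 'rV[R]_(1 + n))).
have consK : cancel (@consv R n) unc.
  move=> [a y]; rewrite /unc /=; congr pair; last exact: row_mxKr.
  have -> : ord0 = lshift n (ord0 : 'I_1) :> 'I_(1 + n) by exact/val_inj.
  by apply: etrans (row_mxEl _ _ ord0 ord0) _; rewrite mxE mulr1n.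
have munc : measurable_fun [set: _] unc.
  apply: measurable_fun_pair; first exact: (measurable_coor ord0).
  apply: measurable_fun_coorP => i.
  under eq_fun do rewrite mxE.
  exact: (measurable_coor (rshift 1 i : 'I_n.+1)).
exists (fun k => unc @^-1` (F k `*` G k)).
  apply/seteqP; split => // x _.
  have [i _ Fi] : (\bigcup_i F i) (unc x).1 by rewrite -FT.
  have [j _ Gj] : (\bigcup_i G i) (unc x).2 by rewrite -GT.
  exists (maxn i j) => //; split.
  - by move: Fi; exact/subsetPset/ndF/leq_maxl.
  - by move: Gj; exact/subsetPset/ndG/leq_maxr.
move=> k; have [mFk Fkoo] := Foo k; have [mGk Gkoo] := Goo k; split.
  by rewrite -[X in measurable X]setTI; apply: munc => //; exact: measurableX.
rewrite /lebesgue_succ /pushforward -comp_preimage.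
rewrite (_ : unc \o _ = id); last by apply/funext => x /=; rewrite consK.
by rewrite product_measure1E// lte_mul_pinfty// ge0_fin_numE.
Qed.

HB.instance Definition _ := @Measure_isSigmaFinite.Build _ _ _ lebesgue_succ
  succ_sigma_finite.
End step.

(* n-fold product of the one-dimensional Lebesgue measure. *)
Fixpoint lebesgue_rV (n : nat) : {sigma_finite_measure set 'rV[R]_n -> \bar R} :=
  if n is n'.+1 then lebesgue_succ (lebesgue_rV n') else \d_(0%R : 'rV[R]_0).
End lebesgue_rV.
Arguments lebesgue_rV {R} n.

Section vector_calculus.
Context {R : realType} {d : nat}.
Implicit Types (f : 'rV[R]_d -> R) (u v : 'rV[R]_d -> 'rV[R]_d).

Definition dot (p q : 'rV[R]_d) : R := \sum_i p ord0 i * q ord0 i.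

(* |p|^2 for the Euclidean norm; the library norm on 'rV is the sup norm. *)
Definition sqn (p : 'rV[R]_d) : R := dot p p.

Definition partial (i : 'I_d) f (x : 'rV[R]_d) : R := 'D_(delta_mx ord0 i) f x.

Definition grad f (x : 'rV[R]_d) : 'rV[R]_d := \row_i partial i f x.

Definition div u (x : 'rV[R]_d) : R :=
  \sum_i partial i (fun y => u y ord0 i) x.

Definition grad_vec u (x : 'rV[R]_d) : 'M[R]_d :=
  \matrix_(i, j) partial j (fun y => u y ord0 i) x.

Definition Dsym u (x : 'rV[R]_d) : 'M[R]_d := grad_vec u x + (grad_vec u x)^T.

Definition convect v u (x : 'rV[R]_d) : 'rV[R]_d :=
  \row_i \sum_j v x ord0 j * partial j (fun y => u y ord0 i) x.

Definition div_tensor (A : 'rV[R]_d -> 'M[R]_d) (x : 'rV[R]_d) : 'rV[R]_d :=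
  \row_i div (fun y => row i (A y)) x.

Definition ddot (A B : 'M[R]_d) : R := \sum_i \sum_j A i j * B i j.

End vector_calculus.

Section regularity.
Context {R : realType}.

(* f is of class C^k on U; meant for U open and V finite dimensional. *)
Fixpoint Ck (V : normedModType R) (k : nat) (U : set V) (f : V -> R) : Prop :=
  if k is k'.+1 then
    (forall x, U x -> differentiable f x) /\ (forall v, Ck k' U ('D_v f))
  else forall x, U x -> {for x, continuous f}.

Definition smooth_upto (d k : nat) (Omega : set 'rV[R]_d) (f : 'rV[R]_d -> R) :=
  exists U : set 'rV[R]_d, [/\ open U, closure Omega `<=` U & Ck k U f].

End regularity.

Section domains.
Context {R : realType} {d : nat}.
Implicit Types (Omega : set 'rV[R]_d) (p x : 'rV[R]_d) (r : R) (j : 'I_d)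
  (below : bool) (g : 'rV[R]_d.-1 -> R).

Definition boundary Omega := closure Omega `\` interior Omega.

Definition graph_point j g (y : 'rV[R]_d.-1) : 'rV[R]_d :=
  \row_i (if unlift j i is Some k then y ord0 k else g y).

Definition area_factor g (y : 'rV[R]_d.-1) : R := Num.sqrt (1 + sqn (grad g y)).

(* Up to relabelling and reorienting the axes, Omega coincides near p with the
   region strictly under the graph of the C^1 function g; col' j x is x with its
   j-th coordinate deleted, and `ball` is an open cube. *)
Definition C1_chart Omega p r j below g :=
  [/\ 0 < r, Ck 1 [set: 'rV[R]_d.-1] g &
   forall x, ball p r x ->
     (Omega x <-> if below then x ord0 j < g (col' j x)
                  else g (col' j x) < x ord0 j)].

Definition bounded_C1_domain Omega :=
  [/\ open Omega, connected Omega, Omega !=set0, bounded_set Omega &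
   forall p, boundary Omega p -> exists r j below g, C1_chart Omega p r j below g].

Definition chart_normal j below g x : 'rV[R]_d :=
  ((if below then 1 else - 1) / area_factor g (col' j x)) *:
  \row_i (if unlift j i is Some k then - partial k g (col' j x) else 1).

Definition outward_unit_normal Omega (nu : 'rV[R]_d -> 'rV[R]_d) :=
  forall p r j below g, C1_chart Omega p r j below g ->
  forall x, boundary Omega x -> ball p r x -> nu x = chart_normal j below g x.

(* sigma is the surface measure ds of the boundary: it is carried by the boundary,
   and over the base of each chart it has density sqrt (1 + |grad g|^2). *)
Definition surface_measure Omega (sigma : {measure set 'rV[R]_d -> \bar R}) :=
  sigma (~` boundary Omega) = 0%E /\
  forall p r j below g, C1_chart Omega p r j below g ->
  forall A : set 'rV[R]_d, measurable A -> A `<=` ball p r ->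
    sigma A = (\int[lebesgue_rV d.-1]_(y in graph_point j g @^-1` A)
                 (area_factor g y)%:E)%E.

End domains.

(* SI units: kelvin, pascal (1 bar = 10^5 Pa), joule, mole. *)
Record pr_fluid (R : realType) := PRFluid {
  Rgas : R;
  Tcrit : R;
  Pcrit : R;
  acentric : R;
  Mweight : R;
  alpha : 'I_4 -> R }.

(* dec k [:: d1; d2; ...] is the decimal number k.d1d2... *)
Definition dec {R : realType} (k : nat) (ds : seq nat) : R :=
  k%:R + foldr (fun c r => (c%:R + r) / 10%:R) 0 ds.

Section peng_robinson.
Context {R : realType} (F : pr_fluid R).
Implicit Types (n T : R).

Definition T0 : R := dec 298 [:: 1; 5].
Definition P0 : R := 10%:R ^+ 5.
Definition vartheta0 : R := - (dec 2478 [:: 9; 5; 6; 8; 7; 5; 1; 2]).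

Definition psi_p T : R := \sum_(i < 4) alpha F i * T ^+ i.

Definition m_pr : R :=
  let w := acentric F in
  if w <= dec 0 [:: 4; 9] then
    dec 0 [:: 3; 7; 4; 6; 4] + dec 1 [:: 5; 4; 2; 2; 6] * w
    - dec 0 [:: 2; 6; 9; 9; 2] * w ^+ 2
  else
    dec 0 [:: 3; 7; 9; 6; 4; 2] + dec 1 [:: 4; 8; 5; 0; 3; 0] * w
    - dec 0 [:: 1; 6; 4; 4; 2; 3] * w ^+ 2 + dec 0 [:: 0; 1; 6; 6; 6; 6] * w ^+ 3.

Definition a_pr T : R :=
  dec 0 [:: 4; 5; 7; 2; 4] * (Rgas F ^+ 2 * Tcrit F ^+ 2 / Pcrit F)
  * (1 + m_pr * (1 - Num.sqrt (T / Tcrit F))) ^+ 2.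

Definition b_pr : R := dec 0 [:: 0; 7; 7; 8; 0] * (Rgas F * Tcrit F / Pcrit F).

Definition oriented_integral (h : R -> R) (s t : R) : R :=
  if s <= t then \int[lebesgue_measure]_(x in `[s, t]) h x
  else - \int[lebesgue_measure]_(x in `[t, s]) h x.

Definition f_ideal n T : R :=
  n * vartheta0
  + n * \sum_(i < 4) alpha F i * ((T ^+ i.+1 - T0 ^+ i.+1) / i.+1%:R)
  - n * Rgas F * (T - T0)
  - n * Rgas F * T * ln (P0 / (n * Rgas F * T))
  - n * T * oriented_integral (fun tau => psi_p tau / tau) T0 T.

Definition f_repulsion n T : R := - (n * Rgas F * T * ln (1 - b_pr * n)).

Definition f_attraction n T : R :=
  a_pr T * n / (2%:R * Num.sqrt 2%:R * b_pr)
  * ln ((1 + (1 - Num.sqrt 2%:R) * b_pr * n)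
        / (1 + (1 + Num.sqrt 2%:R) * b_pr * n)).

Definition f_convex n T : R := f_ideal n T + f_repulsion n T.
Definition f_concave n T : R := f_attraction n T.
Definition f_bulk n T : R := f_convex n T + f_concave n T.

Definition mu_convex n T : R := derive1 (fun m => f_convex m T) n.
Definition mu_concave n T : R := derive1 (fun m => f_concave m T) n.
Definition mu_convex_n n T : R := derive1 (fun m => mu_convex m T) n.

Definition beta1 : R :=
  - (10%:R ^- 16
     / (dec 1 [:: 2; 3; 2; 6] + dec 1 [:: 3; 7; 5; 7] * acentric F)).
Definition beta2 : R :=
  10%:R ^- 16 / (dec 0 [:: 9; 0; 5; 1] + dec 1 [:: 5; 4; 1; 0] * acentric F).

Definition c_inf T : R :=
  a_pr T * b_pr `^ (2%:R / 3%:R) * (beta1 * (1 - T / Tcrit F) + beta2).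

Section gradient_theory.
Context {d : nat}.
Implicit Types p : 'rV[R]_d.

(* p stands for the value of grad n. *)
Definition free_energy n p T : R := f_bulk n T + c_inf T * sqn p / 2%:R.

Definition gamma n p T : R :=
  derive1 (fun t => f_bulk n t) T + derive1 c_inf T * sqn p / 2%:R.

Definition entropy n p T : R := - gamma n p T.

Definition internal_energy n p T : R := free_energy n p T + T * entropy n p T.

Definition internal_energy_T n p T : R :=
  derive1 (fun t => internal_energy n p t) T.

Implicit Types (nf Tf : 'rV[R]_d -> R) (x : 'rV[R]_d).

Definition gamma_at nf Tf x : R := gamma (nf x) (grad nf x) (Tf x).
Definition entropy_at nf Tf x : R := entropy (nf x) (grad nf x) (Tf x).
Definition internal_energy_at nf Tf x : R :=
  internal_energy (nf x) (grad nf x) (Tf x).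

Definition mass_density nf x : R := nf x * Mweight F.

(* mu^{k+1,l+1} in terms of n^k, n^{k+1,l}, n^{k+1,l+1}, T^{k+1,l} *)
Definition mu_next nk nl nl1 Tl x : R :=
  mu_convex (nl x) (Tl x)
  + mu_convex_n (nl x) (Tl x) * (nl1 x - nl x)
  + mu_concave (nk x) (Tl x)
  - div (fun y => c_inf (Tl y) *: grad nl1 y) x.

(* vartheta^{k+1,l+1} in terms of n^{k+1,l+1}, T^{k+1,l}, T^{k+1,l+1} *)
Definition internal_energy_next nl1 Tl Tl1 x : R :=
  internal_energy_at nl1 Tl x
  + internal_energy_T (nl1 x) (grad nl1 x) (Tl x) * (Tl1 x - Tl x).

End gradient_theory.
End peng_robinson.

Definition total_energy {R : realType} {d : nat} (Omega : set 'rV[R]_d)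
    (rho : 'rV[R]_d -> R) (u : 'rV[R]_d -> 'rV[R]_d) (theta : 'rV[R]_d -> R) : R :=
  2%:R^-1 * \int[lebesgue_rV d]_(x in Omega) (rho x * sqn (u x))
  + \int[lebesgue_rV d]_(x in Omega) theta x.

(* Main.v *)
(* The scheme is, inside the domain, a balance law: dotting the momentum equation with
   the new velocity and inserting the definition of us and the mass equation, all bulk
   terms combine with the energy equation into the divergence of one explicit flux
   [energy_flux]. On the boundary the velocities vanish and the fluxes of n and of the
   terms entering us have no normal component, so only the heat flux survives in the
   divergence theorem.

   The divergence theorem is proved coordinatewise for C^1 functions near the closure.
   Multiplying successively by plateau functions, which are 1 on small balls covering the
   closure, reduces it to functions supported in one chart. There, for derivatives
   transversal to the axis of the graph of g, one integrates the sheared function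
   f (y, s + g y): its derivative along the graph integrates to 0 over the half space
   s < 0, and differs from that of f by the normal derivative times the slope of g. *)
Require Import Defs.
From HB Require Import structures.
From mathcomp Require Import all_boot all_order all_algebra.
From mathcomp Require Import all_classical all_reals all_analysis.
From mathcomp Require Import measurable_realfun ring lra.
Import Order.TTheory GRing.Theory Num.Theory.
Import numFieldNormedType.Exports.
Set Implicit Arguments.
Unset Strict Implicit.
Unset Printing Implicit Defensive.
Local Open Scope classical_set_scope.
Local Open Scope ring_scope.

(** Splitting the velocity increment at [us] leaves the squares |u1 - us|^2 and |us - uk|^2 as a
    loss of kinetic energy; the last term of the energy equation is exactly that loss, so the
    balance has no remainder. The flux must be C^1 near the closure, and two of its ingredients are
    not given in that form: [us] is replaced by its formula, and the divergence of n us, which would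
    be only continuous, by the difference quotient of the densities. The integral of the new
    internal energy is likewise read off the balance law, not from regularity of its linearization.

    A chart function is only C^1, so flattening by a general change of variables is avoided: the
    shear translates each line parallel to the axis of the graph, and translation invariance in one
    dimension suffices. No partition of unity is normalized: the final product of the factors 1 -
    bump vanishes on the closure. The surface measure is prescribed only on sets inside chart balls,
    hence its description there as the image of a product measure. *)

(** * Borel sets and measurable functions on row vectors *)

Section measurability.
Context {R : realType}.

Lemma rV_ball n (x y : 'rV[R]_n) (e : R) : 0 < e ->
  ball x e y <-> forall i, `|x ord0 i - y ord0 i| < e.
Proof.
move=> e0; split=> [[_ h] i|h]; first exact: h.
by split => // i j; rewrite (ord1 i); exact: h.
Qed.

Lemma measurable_rV_ball n (x : 'rV[R]_n) (e : R) : measurable (ball x e).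
Proof.
have [e0|e0] := ltP 0 e; last first.
  rewrite (_ : ball x e = set0)//; apply/seteqP; split=> // y [].
  by rewrite ltNge e0.
rewrite (_ : ball x e = \bigcap_(i in [set: 'I_n])
   ((fun y : 'rV[R]_n => y ord0 i : measurableTypeR R) @^-1` (ball (x ord0 i) e))).
  apply: fin_bigcap_measurable => // i _.
  rewrite -[X in measurable X]setTI; apply: measurable_coor => //.
  by rewrite ball_itv.
by apply/seteqP; split=> y /=; [move=> /rV_ball h i _; exact: h|
  move=> h; apply/rV_ball => // i; exact: h].
Qed.

(** The sigma-algebra is generated by coordinates, so an open set is exhausted by countably many
    sets built from them: the cubes with rational centre and rational radius contained in it. *)
Lemma open_measurable_rV n (U : set 'rV[R]_n) : open U -> measurable U.
Proof.
move=> oU.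
pose q (p : 'rV[rat]_n * rat) : set 'rV[R]_n :=
  ball (\row_i (ratr (p.1 ord0 i) : R) : 'rV[R]_n) (ratr p.2 : R).
rewrite (_ : U = \bigcup_(p in [set: 'rV[rat]_n * rat])
    (if `[< q p `<=` U >] then q p else set0)).
  apply: countable_bigcupT_measurable => // p.
  by case: ifPn => // _; exact: measurable_rV_ball.
apply/seteqP; split => [x Ux|x [p _]]; last by case: asboolP => // h /h.
have /nbhs_ballP[e /= e0 xeU] : nbhs x U by exact: open_nbhs_nbhs.
have e20 : 0 < e / 2 by rewrite divr_gt0.
(* With a radius below [e / 2], a rational cube containing x stays within distance e of x. *)
have [r /andP[]] : exists r : rat, 0 < (ratr r : R) < e / 2.
  have [r] := rat_in_itvoo e20.
  by rewrite in_itv/= => h; exists r.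
move=> r0 re.
have h i : exists s : rat, `|x ord0 i - ratr s| < (ratr r : R).
  have : x ord0 i < x ord0 i + ratr r by rewrite ltrDl.
  move=> /rat_in_itvoo[s]; rewrite in_itv/= => /andP[h1 h2]; exists s.
  rewrite ltr_norml; apply/andP; split; first by rewrite ltrBrDl ltrBlDr.
  by rewrite ltrBlDr (lt_le_trans h1)// lerDr ltW.
have [s hs] := choice h.
have e0' : 0 < e by [].
exists (\row_i s i, r) => //; case: asboolP => [_|[]].
  by apply/rV_ball => // i; rewrite !mxE distrC.
move=> y /rV_ball /= -/(_ r0) hy; apply: xeU; apply/rV_ball => // i.
rewrite -(subrKA (ratr (s i))) (le_lt_trans (ler_normD _ _))// [e]splitr.
rewrite ltrD//; first exact: lt_trans (hs i) re.
by have := hy i; rewrite !mxE => /lt_trans; exact.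
Qed.

Lemma continuous_measurable_rV n (U : set 'rV[R]_n) (f : 'rV[R]_n -> R) :
  open U -> (forall x, U x -> {for x, continuous f}) -> measurable_fun U f.
Proof.
move=> oU cf; apply: (measurability _ (RGenOpens.measurableE R)).
move=> _ [_ [a [b ->]] <-]; apply: open_measurable_rV.
rewrite openE => x [Ux fx].
apply: filterI; first exact: open_nbhs_nbhs.
by apply: cf => //; apply: open_nbhs_nbhs; split.
Qed.

End measurability.

(** * Row vectors split into one coordinate and the others *)

Section insertion.
Context {R : realType}.

(** Phrased through [graph_point] of a constant function, so that [graph_point j g y] is convertible
    with [ins j (g y) y] and the facts on insertion apply to graphs. *)
Definition ins n (j : 'I_n.+1) (t : R) (y : 'rV[R]_n) : 'rV[R]_n.+1 :=
  @graph_point R n.+1 j (fun=> t) y.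

Lemma insE1 n (j : 'I_n.+1) t y : ins j t y ord0 j = t.
Proof. by rewrite mxE unlift_none. Qed.

Lemma insE2 n (j : 'I_n.+1) t y k : ins j t y ord0 (lift j k) = y ord0 k.
Proof. by rewrite mxE liftK. Qed.

Lemma ins_consv n t (y : 'rV[R]_n) : ins ord0 t y = consv (t, y).
Proof.
apply/rowP => i; have [k ->|->] := unliftP ord0 i.
  rewrite insE2 (_ : lift ord0 k = rshift 1 k); last exact/val_inj.
  by symmetry; apply: etrans (row_mxEr _ _ ord0 k) _.
rewrite insE1 (_ : ord0 = lshift n (ord0 : 'I_1) :> 'I_(1 + n)); last exact/val_inj.
by symmetry; apply: etrans (row_mxEl _ _ ord0 ord0) _; rewrite mxE mulr1n.
Qed.

(** Exchanges two insertions; this carries the induction on the dimension that frees the integrated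
    coordinate from being the first one. *)
Lemma ins_lift n (j : 'I_n.+1) s t (y : 'rV[R]_n) :
  ins (lift ord0 j) s (ins ord0 t y) = ins ord0 t (ins j s y).
Proof.
apply/rowP => i; have [k ->|->] := unliftP (lift ord0 j) i; last first.
  by rewrite insE1 insE2 insE1.
rewrite insE2; have [l kl|kl] := unliftP ord0 k.
  rewrite kl insE2 (_ : lift _ _ = lift ord0 (lift j l)).
    by rewrite !insE2.
  apply/val_inj => /=; rewrite /bump /= !add1n ltnS; case: leqP => //.
rewrite kl insE1 (_ : lift _ _ = ord0) ?insE1//.
exact/val_inj.
Qed.

Lemma ins_col' n (j : 'I_n.+1) (x : 'rV[R]_n.+1) : ins j (x ord0 j) (col' j x) = x.
Proof.
apply/rowP => i; have [k ->|->] := unliftP j i; last by rewrite insE1.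
by rewrite insE2 mxE.
Qed.

Lemma col'_ins n (j : 'I_n.+1) t (y : 'rV[R]_n) : col' j (ins j t y) = y.
Proof. by apply/rowP => i; rewrite mxE insE2. Qed.

Lemma measurable_rV_coord d (T : measurableType d) n (f : T -> 'rV[R]_n) i :
  measurable_fun setT f -> measurable_fun setT (fun x => f x ord0 i : measurableTypeR R).
Proof. by move=> mf; exact: (measurableT_comp (measurable_coor i)). Qed.

Lemma measurable_ins d (T : measurableType d) n (j : 'I_n.+1)
    (f : T -> measurableTypeR R) (g : T -> 'rV[R]_n) :
  measurable_fun setT f -> measurable_fun setT g ->
  measurable_fun setT (fun x => ins j (f x) (g x)).
Proof.
move=> mf mg; apply: measurable_fun_coorP => i.
have [k ->|->] := unliftP j i.
  by under eq_fun do rewrite insE2; exact: measurable_rV_coord.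
by under eq_fun do rewrite insE1.
Qed.

Lemma measurable_col' n (j : 'I_n.+1) :
  measurable_fun setT (fun x : 'rV[R]_n.+1 => col' j x : 'rV[R]_n).
Proof.
apply: measurable_fun_coorP => i.
by under eq_fun do rewrite mxE; exact: measurable_coor.
Qed.

End insertion.

(** * Integrating out an arbitrary coordinate *)

Section fubini_rV.
Context {R : realType}.
Local Open Scope ereal_scope.
Notation leb := (@lebesgue_measure R).

Lemma tonelli_rV0 n (f : 'rV[R]_n.+1 -> \bar R) : measurable_fun setT f ->
  (forall x, 0 <= f x) ->
  \int[lebesgue_rV n.+1]_x f x = \int[leb]_t \int[lebesgue_rV n]_y f (ins ord0 t y).
Proof.
move=> mf f0.
have mc := @measurable_consv R n.
transitivity (\int[leb \x lebesgue_rV n]_(p in consv @^-1` setT) (f \o consv) p).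
  by rewrite -(@ge0_integral_pushforward _ _ _ _ _ _ mc).
rewrite preimage_setT.
have -> : f \o consv = (fun p : measurableTypeR R * 'rV[R]_n => f (ins ord0 p.1 p.2)).
  by apply/funext => -[t y]/=; rewrite ins_consv.
rewrite (@fubini_tonelli1 _ _ _ _ _ leb (lebesgue_rV n)
  (fun p : measurableTypeR R * 'rV[R]_n => f (ins ord0 p.1 p.2)))//.
by apply: measurableT_comp => //; apply: measurable_ins.
Qed.

Lemma tonelli_rV0' n (f : 'rV[R]_n.+1 -> \bar R) : measurable_fun setT f ->
  (forall x, 0 <= f x) ->
  \int[lebesgue_rV n.+1]_x f x = \int[lebesgue_rV n]_y \int[leb]_t f (ins ord0 t y).
Proof.
move=> mf f0; rewrite tonelli_rV0// (@fubini_tonelli _ _ _ _ _ leb (lebesgue_rV n)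
    (fun p : measurableTypeR R * 'rV[R]_n => f (ins ord0 p.1 p.2)))//.
by apply: measurableT_comp => //; apply: measurable_ins.
Qed.

Lemma measurable_integral_ins d (T : measurableType d) n (j : 'I_n.+1)
    (f : 'rV[R]_n.+1 -> \bar R) (g : T -> 'rV[R]_n) :
  measurable_fun setT f -> (forall x, 0 <= f x) -> measurable_fun setT g ->
  measurable_fun setT (fun x => \int[leb]_t f (ins j t (g x))).
Proof.
move=> mf f0 mg.
apply: (measurableT_comp (f := fun y => \int[leb]_t f (ins j t y))) => //.
apply: (@measurable_fun_fubini_tonelli_F _ _ _ _ _ leb
  (fun p : 'rV[R]_n * measurableTypeR R => f (ins j p.2 p.1))) => //.
by apply: measurableT_comp => //; exact: measurable_ins.
Qed.

(** The measure is built by adding coordinate 0. For another coordinate, coordinate 0 is split off,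
    the induction hypothesis integrates out the wanted one inside, and coordinate 0 is put back
    through [ins_lift]. *)
Lemma tonelli_rV n (j : 'I_n.+1) (f : 'rV[R]_n.+1 -> \bar R) : measurable_fun setT f ->
  (forall x, 0 <= f x) ->
  \int[lebesgue_rV n.+1]_x f x = \int[lebesgue_rV n]_y \int[leb]_t f (ins j t y).
Proof.
elim: n j f => [|n IH] j f mf f0; first by rewrite (ord1 j) tonelli_rV0'.
have [k ->|->] := unliftP ord0 j; last by rewrite tonelli_rV0'.
rewrite tonelli_rV0//.
under eq_integral => t _.
  rewrite (IH k)//; first over.
  by apply: measurableT_comp => //; exact: measurable_ins.
rewrite tonelli_rV0; first last.
- by move=> x; exact: integral_ge0.
- exact: measurable_integral_ins.
by apply: eq_integral => a _; apply: eq_integral => y _; apply: eq_integral => t _;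
  rewrite ins_lift.
Qed.


(** Once the iterated integral is read as one over the product measure, both sides are differences
    of integrals of positive and negative parts, which Tonelli matches. *)
Lemma fubini_rV n (j : 'I_n.+1) (f : 'rV[R]_n.+1 -> \bar R) :
  (lebesgue_rV n.+1).-integrable setT f ->
  \int[lebesgue_rV n.+1]_x f x = \int[lebesgue_rV n]_y \int[leb]_t f (ins j t y).
Proof.
move=> /[dup] /integrableP[mf foo] intf.
have mins : measurable_fun setT (fun p : 'rV[R]_n * measurableTypeR R => ins j p.2 p.1).
  exact: measurable_ins.
have intfi : (lebesgue_rV n \x leb).-integrable setT
   (fun p : 'rV[R]_n * measurableTypeR R => f (ins j p.2 p.1)).
  apply/integrableP; split; first exact: measurableT_comp.
  rewrite fubini_tonelli1//; last by do 2 apply: measurableT_comp => //.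
  by rewrite -(tonelli_rV j (f := fun x => `|f x|))//; exact: measurableT_comp.
rewrite [RHS](integral12_prod_meas1 intfi) integralE [RHS]integralE.
rewrite (tonelli_rV j)//; last exact: measurable_funepos.
rewrite (tonelli_rV j (f := f^\-))//; last exact: measurable_funeneg.
rewrite !fubini_tonelli1//; [|by apply: measurable_funeneg; exact: measurableT_comp|
  by apply: measurable_funepos; exact: measurableT_comp].
by congr (_ - _)%E; apply: eq_integral => y _; apply: eq_integral => t _;
  rewrite ?funeposE ?funenegE.
Qed.

End fubini_rV.

(** * Cubes and measurable functions of bounded support *)

Section cubes.
Context {R : realType}.
Notation leb := (@lebesgue_measure R).

Definition cube n (M : R) : set 'rV[R]_n := [set x | forall i, `|x ord0 i| <= M].

Lemma closed_cube n M : closed (@cube n M).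
Proof.
rewrite (_ : cube M = \bigcap_(i in setT) ((fun x : 'rV[R]_n => x ord0 i) @^-1` [set t | `|t| <= M])).
  apply: closed_bigI => i _; apply: preimage_closed.
    by move=> x _; exact: coord_continuous.
  rewrite (_ : [set _ | _] = `[-M, M]%classic); first exact: interval_closed.
  by apply/seteqP; split=> t /=; rewrite in_itv/= ler_norml.
by apply/seteqP; split=> x /= h i; [move=> _|]; exact: h.
Qed.

Lemma measurable_cube n M : measurable (@cube n M).
Proof.
rewrite -[X in measurable X]setCK; apply: measurableC; apply: open_measurable_rV.
exact/closed_openC/closed_cube.
Qed.

Lemma compact_cube n M : compact (@cube n M).
Proof.
have := @rV_compact R n (fun=> `[-M, M]%classic) (fun=> @segment_compact R _ _).
rewrite (_ : [set _ | _] = cube M)//; apply/seteqP; split=> x /= h i; have := h i.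
  by rewrite in_itv/= ler_norml.
by rewrite in_itv/= ler_norml.
Qed.

Local Open Scope ereal_scope.
Lemma segment_lty (a b : R) : leb `[a, b]%classic < +oo.
Proof. by rewrite lebesgue_measure_itv/=; case: ifP => _; rewrite ?ltry// -EFinB ltry. Qed.

Lemma cube_lty n M : lebesgue_rV n (@cube n M) < +oo.
Proof.
elim: n => [|n IH]; first by rewrite /= diracE; case: (_ \in _); rewrite ltry.
change ((leb \x lebesgue_rV n) (consv @^-1` @cube n.+1 M) < +oo).
rewrite (_ : _ @^-1` _ = (`[(-M)%R, M]%classic : set (measurableTypeR R)) `*` cube M).
  rewrite product_measure1E//; last exact: measurable_cube.
  by rewrite lte_mul_pinfty ?measure_ge0 ?ge0_fin_numE ?segment_lty.
apply/seteqP; split => -[t y] /=; rewrite in_itv/= -(ler_norml t M) -ins_consv.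
  move=> h; split; first by have := h ord0; rewrite insE1.
  by move=> i; have := h (lift ord0 i); rewrite insE2.
move=> [h1 h2] i; have [k ->|->] := unliftP ord0 i; first by rewrite insE2.
by rewrite insE1.
Qed.

End cubes.

Section bounded_support.
Context {R : realType}.
Notation leb := (@lebesgue_measure R).

(** One constant bounds the values and the half-width of the support. Measurability replaces
    continuity because the integrands carry indicators of regions; the class is stable under
    integrating out a coordinate. *)
Definition bounded_supp n (f : 'rV[R]_n -> R) :=
  measurable_fun setT f /\ exists M, forall x, `|f x| <= M /\ (f x != 0 -> cube M x).

Definition bounded_supp1 (f : R -> R) :=
  measurable_fun setT f /\ exists M, forall t, `|f t| <= M /\ (f t != 0 -> `|t| <= M).

Lemma integrable_bounded d (T : measurableType d) (mu : {measure set T -> \bar R})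
    (A : set T) (f : T -> R) (M : R) :
  measurable A -> (mu A < +oo)%E -> measurable_fun setT f ->
  (forall x, `|f x| <= M) -> (forall x, f x != 0 -> A x) ->
  mu.-integrable setT (EFin \o f).
Proof.
move=> mA Aoo mf fM fA.
have -> : EFin \o f = (EFin \o f) \_ A.
  apply/funext => x /=; rewrite patchE; case: ifPn => // /negP xA.
  by have [->//|/fA/mem_set] := eqVneq (f x) 0.
apply/(integrable_mkcond _ mA); apply: measurable_bounded_integrable => //.
  exact: measurable_funS mf.
by exists M; split; [exact: num_real|move=> y My x _; exact: le_trans (fM x) (ltW My)].
Qed.

Lemma bounded_supp_integrable n (f : 'rV[R]_n -> R) : bounded_supp f ->
  (lebesgue_rV n).-integrable setT (EFin \o f).
Proof.
move=> [mf [M fM]]; apply: (@integrable_bounded _ _ _ (cube M) _ M) => //.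
- exact: measurable_cube.
- exact: cube_lty.
- by move=> x; have [] := fM x.
- by move=> x; have [_] := fM x.
Qed.

Lemma bounded_supp1_integrable (f : R -> R) : bounded_supp1 f ->
  leb.-integrable setT (EFin \o f).
Proof.
move=> [mf [M fM]]; apply: (@integrable_bounded _ (measurableTypeR R) leb `[-M, M]%classic _ M) => //.
- exact: segment_lty.
- by move=> x; have [] := fM x.
- by move=> x; have [_ h] := fM x; move=> /h; rewrite /= in_itv/= ler_norml.
Qed.

Lemma bounded_supp_ins n (j : 'I_n.+1) (f : 'rV[R]_n.+1 -> R) y : bounded_supp f ->
  bounded_supp1 (fun t => f (ins j t y)).
Proof.
move=> [mf [M fM]]; split.
  by apply: measurableT_comp => //; exact: measurable_ins.
exists M => t; have [h1 h2] := fM (ins j t y); split=> // /h2 /(_ j).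
by rewrite insE1.
Qed.

Lemma bounded_supp_Rintegral n (j : 'I_n.+1) (f : 'rV[R]_n.+1 -> R) : bounded_supp f ->
  bounded_supp (fun y => \int[leb]_t f (ins j t y)).
Proof.
move=> bf; have [mf [M fM]] := bf.
have M0 : 0 <= M by rewrite (le_trans _ (proj1 (fM 0))).
split.
  apply: (measurableT_comp (f := fine)) => //.
  under eq_fun do rewrite integralE.
  apply: emeasurable_funB.
    rewrite (_ : (fun _ => _) = fun y => \int[leb]_t (EFin \o f)^\+ (ins j t y))%E.
      apply: (@measurable_integral_ins _ _ _ _ j ((EFin \o f)^\+)%E id) => //.
      by apply: measurable_funepos; exact/measurable_EFinP.
    by apply/funext => y; apply: eq_integral => t _; rewrite !funeposE.
  rewrite (_ : (fun _ => _) = fun y => \int[leb]_t (EFin \o f)^\- (ins j t y))%E.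
    apply: (@measurable_integral_ins _ _ _ _ j ((EFin \o f)^\-)%E id) => //.
    by apply: measurable_funeneg; exact/measurable_EFinP.
  by apply/funext => y; apply: eq_integral => t _; rewrite !funenegE.
(* The summand [M] controls the support; [M * (M + M)] is the bound on the values times the length
   of the segment from -M to M. *)
exists (M + M * (M + M)) => y; split.
  rewrite ler_wpDl//.
  have fi := bounded_supp1_integrable (bounded_supp_ins j y bf).
  rewrite (le_trans (le_normr_Rintegral _ fi))//.
  rewrite (_ : M * (M + M) = \int[leb]_(t in `[-M, M]) M); last first.
    rewrite Rintegral_cst//= lebesgue_measure_itv/= lte_fin.
    by case: ltP => h //=; [rewrite opprK|]; rewrite ?mulr0; nra.
  rewrite (_ : \int[leb]_t _ = \int[leb]_(t in `[-M, M]) `|f (ins j t y)|); last first.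
    rewrite [RHS]Rintegral_mkcond; apply: eq_Rintegral => t _.
    rewrite patchE; case: ifPn => // /negP tM.
    have [->|/(proj2 (fM _)) /(_ j)] := eqVneq (f (ins j t y)) 0; first by rewrite normr0.
    by rewrite insE1 => h; case: tM; rewrite inE/= in_itv/= -ler_norml.
  apply: le_Rintegral => //.
  - by apply: integrable_norm => //; exact: integrableS fi.
  - by apply: measurable_bounded_integrable => //; [exact: segment_lty|exists M; split;
    rewrite ?num_real// => z Mz t _; rewrite ger0_norm// ltW].
  - by move=> t _; have [] := fM (ins j t y).
move=> h i; rewrite (@le_trans _ _ M)//; last by rewrite lerDl mulr_ge0// addr_ge0.
rewrite leNgt; apply/negP => My; move/eqP: h; apply.
rewrite (_ : (fun t => _) = cst 0).
  by rewrite Rintegral_cst//= mul0r.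
apply/funext => t /=; apply/eqP; apply: contraTT My => /(proj2 (fM _)) /(_ (lift j i)).
by rewrite insE2 leNgt.
Qed.

Lemma Rfubini_rV n (j : 'I_n.+1) (f : 'rV[R]_n.+1 -> R) : bounded_supp f ->
  \int[lebesgue_rV n.+1]_x f x = \int[lebesgue_rV n]_y \int[leb]_t f (ins j t y).
Proof.
move=> bf; rewrite /Rintegral (fubini_rV j); last exact: bounded_supp_integrable.
congr fine; apply: eq_integral => y _; rewrite fineK//.
by apply: integrable_fin_num => //; exact: (bounded_supp1_integrable (bounded_supp_ins j y bf)).
Qed.

End bounded_support.

(** * Calculus of C^k functions on open sets *)

Section near_differentiable.
Context {R : numFieldType} {V W : normedModType R}.

Lemma near_eq0_differentiable (h : V -> W) (x : V) :
  (\forall y \near x, h y = 0) -> differentiable h x.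
Proof.
move=> h0.
have E : h \o shift x = cst (h x) + (0 : V -> W) +o_ (0 : V) id.
  apply/eqaddoP => e e0.
  have : \forall y \near (0 : V), h (y + x) = 0.
    rewrite (near_shift x); apply: filterS h0 => z hz /=.
    by rewrite sub0r subrK.
  apply: filterS => y hy.
  rewrite /= [X in `|X|](_ : _ = h (y + x) - (h x + 0))// hy (nbhs_singleton h0).
  by rewrite addr0 subr0 normr0 mulr_ge0// ltW.
have d0 : 'd h x = 0 :> (V -> W).
  by apply: diff_unique => //; exact: cst_continuous.
apply/diff_locallyP; rewrite d0; split => //; exact: cst_continuous.
Unshelve. all: by end_near. Qed.

Lemma near_eq_differentiable (f g : V -> W) (x : V) :
  (\forall y \near x, f y = g y) -> differentiable f x -> differentiable g x.
Proof.
move=> fg df.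
rewrite (_ : g = f + (g - f)); last by rewrite addrC subrK.
apply: differentiableD => //; apply: near_eq0_differentiable.
by apply: filterS fg => y /= fgy; rewrite [LHS](_ : _ = g y - f y)// fgy subrr.
Qed.

End near_differentiable.

Section Ck_theory.
Context {R : realType} {V : normedModType R}.
Implicit Types (U W : set V) (f g : V -> R) (k : nat).

Lemma nearU U x : open U -> U x -> \forall y \near x, U y.
Proof. by move=> oU Ux; exact: open_nbhs_nbhs. Qed.

Lemma eq_derive_on U f g v : open U -> (forall x, U x -> f x = g x) ->
  forall x, U x -> 'D_v f x = 'D_v g x.
Proof.
move=> oU fg x Ux; apply: near_eq_derive.
by apply: filterS (nearU oU Ux) => y /fg.
Qed.

(** [Ck] speaks of total functions, while product and chain rules describe ['D_v f] only on U. The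
    differentiation rules below establish a formula on U and transport the class along it. *)
Lemma Ck_eq k U f g : open U -> (forall x, U x -> f x = g x) ->
  Ck k U f -> Ck k U g.
Proof.
move=> oU; elim: k f g => [|k IH] f g fg /=.
  move=> cf x Ux; have := cf x Ux; rewrite /prop_for /continuous_at => fx. rewrite -(fg x Ux).
  apply: cvg_trans fx; apply: near_eq_cvg.
  by apply: filterS (nearU oU Ux) => y /fg.
move=> [df Df]; split=> [x Ux|v].
  apply: near_eq_differentiable (df x Ux).
  by apply: filterS (nearU oU Ux) => y /fg.
by apply: IH (Df v); exact: eq_derive_on.
Qed.

Lemma Ck_sub k U W f : W `<=` U -> Ck k U f -> Ck k W f.
Proof.
move=> WU; elim: k f => [|k IH] f /= => [cf x /WU|[df Df]]; first exact: cf.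
by split=> [x /WU/df|v]//; exact: IH.
Qed.

(** Regularity is local, so classes on two sets covering the space glue. This serves to extend by
    zero a product with a bump function whose other factor is regular only near the closure. *)
Lemma Ck_local k U W f : Ck k U f -> Ck k W f ->
  (forall x, U x \/ W x) -> Ck k setT f.
Proof.
elim: k f => [|k IH] f /=.
  by move=> cU cW UW x _; case: (UW x) => [/cU|/cW].
move=> [dU DU] [dW DW] UW; split=> [x _|v]; last exact: IH.
by case: (UW x) => [/dU|/dW].
Qed.

Lemma Ck_S k U f : Ck k.+1 U f -> Ck k U f.
Proof.
elim: k f => [|k IH] f [df Df].
  by move=> x /df; exact: differentiable_continuous.
by split=> // v; exact/IH/Df.
Qed.

Lemma Ck_le k l U f : (l <= k)%N -> Ck k U f -> Ck l U f.
Proof. by move=> /subnK <-; elim: (k - l)%N => // m IH /Ck_S. Qed.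

Lemma Ck_continuous k U f x : Ck k U f -> U x -> {for x, continuous f}.
Proof. by move=> /(Ck_le (leq0n k)); exact. Qed.

Lemma Ck_differentiable k U f x : Ck k.+1 U f -> U x -> differentiable f x.
Proof. by move=> [df _] /df. Qed.

Lemma Ck_derivable k U f x v : Ck k.+1 U f -> U x -> derivable f x v.
Proof. by move=> [df _] /df; exact: diff_derivable. Qed.

Lemma Ck_cst k U (a : R) : Ck k U (cst a).
Proof.
elim: k a => [|k IH] a /=; first by move=> x _; exact: cst_continuous.
split=> [x _|v]; first exact: differentiable_cst.
by rewrite (_ : 'D_v (cst a) = cst 0)//; apply/funext => x; rewrite derive_cst.
Qed.

Lemma Ck_D k U f g : open U -> Ck k U f -> Ck k U g -> Ck k U (fun x => f x + g x).
Proof.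
move=> oU; elim: k f g => [|k IH] f g /=.
  by move=> cf cg x Ux; apply: continuousD; [exact: cf|exact: cg].
move=> [df Df] [dg Dg]; split=> [x Ux|v].
  by apply: differentiableD; [exact: df|exact: dg].
apply: Ck_eq (IH _ _ (Df v) (Dg v)) => // x Ux.
by rewrite deriveD//; apply: diff_derivable; [exact: df|exact: dg].
Qed.

Lemma Ck_M k U f g : open U -> Ck k U f -> Ck k U g -> Ck k U (fun x => f x * g x).
Proof.
move=> oU; elim: k f g => [|k IH] f g /=.
  by move=> cf cg x Ux; apply: continuousM; [exact: cf|exact: cg].
move=> /[dup] Cf [df Df] /[dup] Cg [dg Dg]; split=> [x Ux|v].
  by apply: differentiableM; [exact: df|exact: dg].
have H := Ck_D oU (IH _ _ (Ck_S Cf) (Dg v)) (IH _ _ (Ck_S Cg) (Df v)).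
apply: Ck_eq H => // x Ux.
by rewrite deriveM//; apply: diff_derivable; [exact: df|exact: dg].
Qed.

Lemma Ck_N k U f : open U -> Ck k U f -> Ck k U (fun x => - f x).
Proof.
move=> oU Cf; apply: Ck_eq (Ck_M oU (Ck_cst k U (-1)) Cf) => // x _.
by rewrite mulN1r.
Qed.

Lemma Ck_B k U f g : open U -> Ck k U f -> Ck k U g -> Ck k U (fun x => f x - g x).
Proof. by move=> oU Cf Cg; apply: Ck_D => //; exact: Ck_N. Qed.

Lemma Ck_X k U f n : open U -> Ck k U f -> Ck k U (fun x => f x ^+ n).
Proof.
move=> oU Cf; elim: n => [|n IH]; first exact: Ck_cst.
by apply: Ck_eq (Ck_M oU Cf IH) => // x _; rewrite exprS.
Qed.

Lemma Ck_sum k U n (F : 'I_n -> V -> R) : open U ->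
  (forall i, Ck k U (F i)) -> Ck k U (fun x => \sum_i F i x).
Proof.
move=> oU; elim: n F => [|n IH] F CF.
  by apply: Ck_eq (Ck_cst k U 0) => // x _; rewrite big_ord0.
apply: Ck_eq (Ck_D oU (CF ord0) (IH (fun i => F (lift ord0 i)) _)) => // x _.
by rewrite big_ord_recl.
Qed.

Lemma derive_chain (phi : R -> R) f x v : derivable phi (f x) 1 -> differentiable f x ->
  differentiable (phi \o f) x /\ 'D_v (phi \o f) x = 'D_1 phi (f x) * 'D_v f x.
Proof.
move=> dphi df; have dphi' : differentiable phi (f x) by exact/derivable1_diffP.
have d : differentiable (phi \o f) x by exact: differentiable_comp.
split => //; rewrite !deriveE// diff_comp//=.
by rewrite -[X in 'd phi _ X]mulr1 -[X in 'd phi _ X]/('d f x v *: 1) linearZ mulrC.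
Qed.

(** Raises the class by one from an expression of the derivative. For the inverse and the square
    root that expression involves the function itself, so an induction on k closes. *)
Lemma Ck_comp_step k U f (phi phi' : R -> R) : open U -> 
  (forall x, U x -> is_derive (f x) 1 phi (phi' (f x))) ->
  Ck k.+1 U f -> Ck k U (phi' \o f) -> Ck k.+1 U (phi \o f).
Proof.
move=> oU dphi /[dup] Cf [df Df] C'.
have H x v : U x -> differentiable (phi \o f) x /\
    'D_v (phi \o f) x = phi' (f x) * 'D_v f x.
  move=> Ux; have dx := dphi x Ux.
  by have := derive_chain v (@ex_derive _ _ _ _ _ _ _ dx) (df x Ux); rewrite derive_val.
split=> [x Ux|v]; first exact: (proj1 (H x 0 Ux)).
by apply: Ck_eq (Ck_M oU C' (Df v)) => // x /(H x v)[].
Qed.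

Lemma Ck_V k U f : open U -> (forall x, U x -> f x != 0) -> Ck k U f ->
  Ck k U (fun x => (f x)^-1).
Proof.
move=> oU f0; elim: k => [|k IH].
  by move=> cf x Ux; apply: continuousV; [exact: f0|exact: cf].
move=> Cf; apply: (@Ck_comp_step _ _ _ (fun t => t^-1) (fun t => - t ^- 2)) => //.
  move=> x Ux; have -> : - f x ^- 2 = - f x ^- 2 *: (1 : R) by rewrite /GRing.scale/= mulr1.
  have := @is_deriveV R id (f x) 1 1 (f0 x Ux) (is_derive_id _ _).
  exact.
apply: Ck_N => //; apply: Ck_eq (Ck_X 2 oU (IH (Ck_S Cf))) => // x _ /=.
by rewrite exprVn.
Qed.

Lemma Ck_ln k U f : open U -> (forall x, U x -> 0 < f x) -> Ck k U f ->
  Ck k U (fun x => ln (f x)).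
Proof.
move=> oU f0; case: k => [|k] Cf.
  by move=> x Ux; apply: (continuous_comp (g := @ln R)); [exact: Cf|exact: continuous_ln (f0 x Ux)].
apply: (@Ck_comp_step _ _ _ (@ln R) (fun t => t^-1)) => //.
  by move=> x Ux; exact: is_derive1_ln (f0 x Ux).
by apply: Ck_V => //; [move=> x /f0; rewrite lt0r => /andP[]|exact: Ck_S].
Qed.

Lemma Ck_sqrt k U f : open U -> (forall x, U x -> 0 < f x) -> Ck k U f ->
  Ck k U (fun x => Num.sqrt (f x)).
Proof.
move=> oU f0; elim: k => [|k IH] Cf.
  by move=> x Ux; apply: (continuous_comp (g := @Num.sqrt R)); [exact: Cf|exact: sqrt_continuous].
apply: (@Ck_comp_step _ _ _ (@Num.sqrt R) (fun t => (2 * Num.sqrt t)^-1)) => //.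
  by move=> x Ux; exact: is_derive1_sqrt (f0 x Ux).
apply: Ck_V => //.
  by move=> x /f0 fx; rewrite /= mulf_neq0// gt_eqF// sqrtr_gt0.
by apply: Ck_M => //; [exact: Ck_cst|exact/IH/Ck_S].
Qed.

End Ck_theory.

(** * One-dimensional integrals over half lines, and translations *)

Section half_line.
Context {R : realType}.
Notation leb := (@lebesgue_measure R).

(** The indicator of the side of [a] on which the domain lies in a chart of orientation [b];
    [side_sign b] is the sign of the outward direction along the axis. *)
Definition half_ray (b : bool) (a t : R) : R :=
  if (if b then t < a else a < t) then 1 else 0.

Definition side_sign (b : bool) : R := if b then 1 else -1.

Lemma half_ray_le1 b a t : `|half_ray b a t| <= 1.
Proof. by rewrite /half_ray; case: ifP; rewrite ?normr1 ?normr0 ?ler01. Qed.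

Lemma measurable_half_ray b d (T : measurableType d) (f g : T -> R) :
  measurable_fun setT f -> measurable_fun setT g ->
  measurable_fun setT (fun x => half_ray b (f x) (g x)).
Proof.
move=> mf mg; rewrite /half_ray; apply: measurable_fun_ifT => //.
by case: b; exact: measurable_fun_ltr.
Qed.

Lemma derive_off_support (phi : R -> R) M : (forall t, phi t != 0 -> `|t| <= M) ->
  forall t, 'D_1 phi t != 0 -> `|t| <= M.
Proof.
move=> phiM t; apply: contraNT; rewrite -ltNge => Mt.
rewrite (@near_eq_derive _ _ _ phi (cst 0)) ?derive_cst//.
have : \forall s \near t, M < `|s|.
  by have := @norm_continuous _ R t; move=> /cvgr_gt; apply.
by apply: filterS => s; rewrite ltNge; apply: contraNeq => /phiM.
Qed.

Lemma integral_derive_half_ray b a (phi : R -> R) : (forall t, derivable phi t 1) ->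
  continuous ('D_1 phi) -> (exists M, forall t, phi t != 0 -> `|t| <= M) ->
  \int[leb]_t (half_ray b a t * 'D_1 phi t) = side_sign b * phi a.
Proof.
move=> dphi cphi [M phiM].
have DM := derive_off_support phiM.
have cp : continuous phi.
  by move=> t; apply: differentiable_continuous; exact/derivable1_diffP.
(* From distance [L] on both [phi] and its derivative vanish, and [a] lies strictly inside, so the
   half line may be cut to a bounded interval. *)
pose L := Num.max M `|a| + 1.
have ML : M < L by rewrite ltr_pwDr// le_max lexx.
have : `|a| < L by rewrite ltr_pwDr// le_max lexx orbT.
rewrite ltr_norml => /andP[La aL].
have phiL t : L <= `|t| -> phi t = 0.
  by move=> Lt; apply/eqP; apply: contraTT Lt => /phiM; rewrite -ltNge; move/le_lt_trans; apply.
have DL t : L <= `|t| -> 'D_1 phi t = 0.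
  by move=> Lt; apply/eqP; apply: contraTT Lt => /DM; rewrite -ltNge; move/le_lt_trans; apply.
have L0 : 0 < L by lra.
have FTC x y : x < y -> \int[leb]_(t in `[x, y]) 'D_1 phi t = phi y - phi x.
  move=> xy; rewrite /Rintegral (@continuous_FTC2 _ _ phi)//.
  - by apply: continuous_subspaceT.
  - split => //; first by apply: cvg_at_right_filter; exact: cp.
    by apply: cvg_at_left_filter; exact: cp.
  - by move=> z _; rewrite derive1E.
have mD x y (A : set R) : measurable A -> A `<=` `[x, y]%classic ->
    leb.-integrable A (EFin \o 'D_1 phi).
  move=> mA sA; apply: (@integrableS _ _ _ leb `[x, y]%classic) => //.
  apply: continuous_compact_integrable; first exact: segment_compact.
  exact: continuous_subspaceT.
rewrite /half_ray /side_sign; case: b.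
  transitivity (\int[leb]_(t in `[-L, a[) 'D_1 phi t).
    rewrite [RHS]Rintegral_mkcond; apply: eq_Rintegral => t _.
    rewrite patchE mem_setE in_itv/=; case: (ltP t a) => ta; case: (leP (- L) t) => Lt /=.
    - by rewrite mul1r.
    - by rewrite mul1r DL// ler0_norm; lra.
    - by rewrite mul0r.
    - by rewrite mul0r.
  rewrite Rintegral_itv_bndo_bndc; last by apply: (mD (- L) a) => //; exact: subset_itv_co_cc.
  by rewrite FTC ?(phiL (- L)) ?subr0 ?mul1r ?normrN ?ger0_norm; lra.
transitivity (\int[leb]_(t in `]a, L]) 'D_1 phi t).
  rewrite [RHS]Rintegral_mkcond; apply: eq_Rintegral => t _.
  rewrite patchE mem_setE in_itv/=; case: (ltP a t) => ta; case: (leP t L) => Lt /=.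
  - by rewrite mul1r.
  - by rewrite mul1r DL// ger0_norm; lra.
  - by rewrite mul0r.
  - by rewrite mul0r.
rewrite Rintegral_itv_obnd_cbnd; last by apply: (mD a L) => //; exact: subset_itv_oc_cc.
by rewrite FTC ?(phiL L) ?sub0r ?mulN1r ?ger0_norm; lra.
Qed.

Lemma integral_derive0 (phi : R -> R) : (forall t, derivable phi t 1) ->
  continuous ('D_1 phi) -> (exists M, forall t, phi t != 0 -> `|t| <= M) ->
  \int[leb]_t ('D_1 phi t) = 0.
Proof.
move=> dphi cphi /[dup] phiM' [M phiM].
have DM := derive_off_support phiM.
(* The half line ending at [M + 1] contains the support, and the boundary value [phi (M + 1)] is
   0. *)
transitivity (\int[leb]_t (half_ray true (M + 1) t * 'D_1 phi t)).
  apply: eq_Rintegral => t _; rewrite /half_ray; case: ifPn; rewrite ?mul1r// -leNgt mul0r => Mt.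
  apply/eqP; apply: contraTT Mt => /DM; rewrite ler_norml -ltNge; lra.
rewrite integral_derive_half_ray// [phi _](_ : _ = 0) ?mulr0//.
by apply/eqP/negP => /negP /phiM; rewrite ler_norml; lra.
Qed.

Lemma bounded_supp1_shift (f : R -> R) (c : R) : bounded_supp1 f ->
  bounded_supp1 (fun t => f (t + c)).
Proof.
move=> [mf [M fM]]; split.
  by apply: measurableT_comp => //; exact: measurable_funD.
exists (M + `|c|) => t; have [h1 h2] := fM (t + c); split.
  by rewrite (le_trans h1)// lerDl.
by move=> /h2 h; rewrite -[t](addrK c) (le_trans (ler_normB _ _))// lerD2r.
Qed.

(** The image of Lebesgue measure under a translation gives half-open intervals their length, which
    determines the measure. *)
Lemma lebesgue_measure_shift (c : R) (A : set (measurableTypeR R)) : measurable A ->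
  leb A = leb ((fun t => t + c) @^-1` A).
Proof.
have mphi : measurable_fun setT (fun t : measurableTypeR R => t + c : measurableTypeR R).
  exact: measurable_funD.
pose phi : {mfun measurableTypeR R >-> measurableTypeR R} :=
  HB.pack (fun t : measurableTypeR R => t + c : measurableTypeR R)
    (isMeasurableFun.Build _ _ _ _ _ mphi).
apply: (@lebesgue_measure_unique _ (pushforward leb phi)) => _ [[a b] _ <-] /=.
rewrite /pushforward (_ : _ @^-1` _ = `]a - c, b - c]%classic).
  rewrite !lebesgue_measure_itv/= !lte_fin ltrD2r.
  by case: ifP => // _; rewrite -!EFinD; congr EFin; ring.
by apply/seteqP; split=> t /=; rewrite !in_itv/= ltrBlDr lerBrDr.
Qed.

Lemma integral_shift (f : R -> R) (c : R) : bounded_supp1 f ->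
  \int[leb]_t f t = \int[leb]_t f (t + c).
Proof.
move=> bf; have [mf _] := bf; congr fine.
have mphi : measurable_fun setT (fun t : measurableTypeR R => t + c : measurableTypeR R).
  exact: measurable_funD.
pose phi : {mfun measurableTypeR R >-> measurableTypeR R} :=
  HB.pack (fun t : measurableTypeR R => t + c : measurableTypeR R)
    (isMeasurableFun.Build _ _ _ _ _ mphi).
transitivity (\int[pushforward leb phi]_t (f t)%:E)%E.
  by apply: eq_measure_integral => A mA _; exact: lebesgue_measure_shift.
rewrite (integral_pushforward mphi)//; first exact/measurable_EFinP.
by rewrite preimage_setT; exact: (bounded_supp1_integrable (bounded_supp1_shift c bf)).
Qed.

End half_line.

(** * Continuity and partial derivatives along coordinate lines *)

Section coordinates.
Context {R : realType}.
Notation leb := (@lebesgue_measure R).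

Lemma continuous_add (T : topologicalType) (f g : T -> R) :
  continuous f -> continuous g -> continuous (fun x => f x + g x).
Proof. by move=> cf cg x; exact: cvgD (cf x) (cg x). Qed.

Lemma continuous_mul (T : topologicalType) (f g : T -> R) :
  continuous f -> continuous g -> continuous (fun x => f x * g x).
Proof. by move=> cf cg x; exact: cvgM (cf x) (cg x). Qed.

Lemma continuous_inv (T : topologicalType) (f : T -> R) : (forall x, f x != 0) ->
  continuous f -> continuous (fun x => (f x)^-1).
Proof. by move=> f0 cf x; exact: cvgV (f0 x) (cf x). Qed.

Lemma continuous_sum (T : topologicalType) m (F : 'I_m -> T -> R) :
  (forall i, continuous (F i)) -> continuous (fun x => \sum_i F i x).
Proof.
elim: m F => [|m IH] F cF.
  rewrite (_ : (fun _ => _) = cst 0); first exact: cst_continuous.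
  by apply/funext => x; rewrite big_ord0.
rewrite (_ : (fun _ => _) = fun x => F ord0 x + \sum_i F (lift ord0 i) x).
  by apply: continuous_add; [exact: cF|apply: IH => i; exact: cF].
by apply/funext => x; rewrite big_ord_recl.
Qed.

Lemma continuous_compose (T T' T'' : topologicalType) (f : T -> T') (g : T' -> T'') :
  continuous f -> continuous g -> continuous (fun x => g (f x)).
Proof. by move=> cf cg x; apply: continuous_comp; [exact: cf|exact: cg]. Qed.

Lemma continuous_rV (T : topologicalType) n (phi : T -> 'rV[R]_n) (x : T) :
  (forall i, {for x, continuous (fun t => phi t ord0 i)}) -> {for x, continuous phi}.
Proof.
move=> cphi; apply/cvgrPdist_lt => e e0.
have : \forall t \near x, forall i, `|phi x ord0 i - phi t ord0 i| < e.
  apply: filter_forall => i.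
  by have /cvgrPdist_lt := cphi i; apply.
by apply: filterS => t /(rV_ball _ _ e0); rewrite mx_norm_ball.
Qed.

Lemma ins_line n (j : 'I_n.+1) h t (y : 'rV[R]_n) :
  ins j (h + t) y = h *: delta_mx ord0 j + ins j t y.
Proof.
apply/rowP => i; rewrite !mxE eqxx/=; have [k ->|->] := unliftP j i.
  by rewrite eq_sym (negbTE (neq_lift j k)) mulr0 add0r.
by rewrite eqxx mulr1.
Qed.

Let growth_ins n (j : 'I_n.+1) (f : 'rV[R]_n.+1 -> R) y t :
  (fun h => h^-1 *: (((fun s => f (ins j s y)) \o shift t) (h *: (1 : R)) - f (ins j t y))) =
  (fun h => h^-1 *: ((f \o shift (ins j t y)) (h *: delta_mx ord0 j) - f (ins j t y))).
Proof. by apply/funext => h /=; rewrite -ins_line /GRing.scale/= mulr1. Qed.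

Lemma derive_ins n (j : 'I_n.+1) (f : 'rV[R]_n.+1 -> R) y t :
  'D_1 (fun s => f (ins j s y)) t = partial j f (ins j t y).
Proof. by rewrite /partial /derive growth_ins. Qed.

Lemma derivable_ins n (j : 'I_n.+1) (f : 'rV[R]_n.+1 -> R) y t :
  derivable f (ins j t y) (delta_mx ord0 j) ->
  derivable (fun s => f (ins j s y)) t 1.
Proof. by rewrite /derivable growth_ins. Qed.

(** The complement of A is open, so f vanishes near each point outside A, and its derivatives vanish
    there too. *)
Lemma partial_off_closed n i (f : 'rV[R]_n -> R) (A : set 'rV[R]_n) x : closed A ->
  (forall x, f x != 0 -> A x) -> partial i f x != 0 -> A x.
Proof.
move=> cA fA; have [//|nA] := pselect (A x).
rewrite /partial (@near_eq_derive _ _ _ f (cst 0)) ?derive_cst ?eqxx//.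
by apply: filterS (nearU (closed_openC cA) nA) => y; apply: contra_notP => /eqP/fA.
Qed.

Lemma partial_off_support n i (f : 'rV[R]_n -> R) M x :
  (forall x, f x != 0 -> cube M x) -> partial i f x != 0 -> cube M x.
Proof. by move=> fM; apply: partial_off_closed => //; exact: closed_cube. Qed.

Lemma continuous_cube_bounded n (f : 'rV[R]_n -> R) M : continuous f ->
  exists K, forall x, cube M x -> `|f x| <= K.
Proof.
move=> cf; have [K [_ HK]] : bounded_set (f @` @cube R n M).
  apply: compact_bounded; apply: continuous_compact; last exact: compact_cube.
  exact: continuous_subspaceT.
by exists (K + 1) => x Mx; apply: (HK (K + 1)); [rewrite ltrDl|exists x].
Qed.

Lemma bounded_suppP n (f : 'rV[R]_n -> R) K M : measurable_fun setT f ->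
  (forall x, f x != 0 -> cube M x) -> (forall x, cube M x -> `|f x| <= K) -> bounded_supp f.
Proof.
move=> mf fM fK; split => //; exists (Num.max 0 (Num.max K M)) => x; split.
  have [->|/fM/fK h] := eqVneq (f x) 0; first by rewrite normr0 le_max lexx.
  by rewrite !le_max h !orbT.
by move=> /fM h i; rewrite !le_max h !orbT.
Qed.

Lemma continuous_measurable n (f : 'rV[R]_n -> R) : continuous f -> measurable_fun setT f.
Proof. by move=> cf; apply: (@continuous_measurable_rV _ _ setT) => [|x _]; [exact: openT|
  exact: cf]. Qed.

Lemma C1_continuous n (f : 'rV[R]_n -> R) : Ck 1 setT f -> continuous f.
Proof. by move=> Cf x; exact: (Ck_continuous Cf). Qed.

Lemma C1_partial n i (f : 'rV[R]_n -> R) : Ck 1 setT f -> continuous (partial i f).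
Proof. by move=> [_ Df] x; exact: (Df (delta_mx ord0 i) x). Qed.

Lemma ins_continuous n (j : 'I_n.+1) (y : 'rV[R]_n) : continuous (fun t => ins j t y).
Proof.
move=> t; apply: continuous_rV => i; have [k ->|->] := unliftP j i.
  rewrite (_ : (fun _ => _) = cst (y ord0 k)); first exact: cst_continuous.
  by apply/funext => s; exact: insE2.
rewrite (_ : (fun _ => _) = id); first by move=> ?.
by apply/funext => s; exact: insE1.
Qed.

Lemma col'_continuous n (j : 'I_n.+1) : continuous (fun x : 'rV[R]_n.+1 => col' j x : 'rV[R]_n).
Proof.
move=> x; apply: continuous_rV => i.
rewrite (_ : (fun _ => _) = (fun x : 'rV[R]_n.+1 => x ord0 (lift j i))).
  exact: coord_continuous.
by apply/funext => z; rewrite mxE.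
Qed.

End coordinates.

(** * Integration by parts on one side of a graph *)

Section shear.
Context {R : realType} {n : nat}.
Notation leb := (@lebesgue_measure R).
Variables (f : 'rV[R]_n.+1 -> R) (g : 'rV[R]_n -> R) (j : 'I_n.+1).
Hypotheses (Cf : Ck 1 setT f) (Cg : Ck 1 setT g).

Let S (x : 'rV[R]_n.+1) : 'rV[R]_n.+1 := ins j (x ord0 j + g (col' j x)) (col' j x).
Definition shear x := f (S x).

Let SE x : S x = x + g (col' j x) *: delta_mx ord0 j.
Proof. by rewrite /S addrC ins_line ins_col' addrC. Qed.

Let S_continuous : continuous S.
Proof.
move=> x; apply: continuous_rV => i; have [k ->|->] := unliftP j i.
  rewrite (_ : (fun _ => _) = (fun x : 'rV[R]_n.+1 => col' j x ord0 k)).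
    apply: (@continuous_comp _ _ _ (fun x : 'rV[R]_n.+1 => col' j x : 'rV[R]_n) (fun y : 'rV[R]_n => y ord0 k)).
      exact: col'_continuous.
    exact: coord_continuous.
  by apply/funext => z; rewrite insE2.
rewrite (_ : (fun _ => _) = (fun x : 'rV[R]_n.+1 => x ord0 j + g (col' j x))).
  apply: continuousD; first exact: coord_continuous.
  apply: (@continuous_comp _ _ _ (fun x : 'rV[R]_n.+1 => col' j x : 'rV[R]_n) g).
    exact: col'_continuous.
  exact: C1_continuous.
by apply/funext => z; rewrite insE1.
Qed.

(** Chain rule along a line in a coordinate direction other than j: its image under [S] has as
    velocity that direction plus the slope of g times the axis vector. *)
Lemma shear_partial k x :
  derivable shear x (delta_mx ord0 (lift j k)) /\
  partial (lift j k) shear x =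
    partial (lift j k) f (S x) + partial j f (S x) * partial k g (col' j x).
Proof.
set e := delta_mx _ _.
(* [c] is the image under [S] of the line through x with direction [e]. *)
pose c (h : R) : 'rV[R]_n.+1 := x + h *: e + g (col' j x + h *: delta_mx ord0 k) *: delta_mx ord0 j.
have Sc h : S (h *: e + x) = c h.
  rewrite SE /c [h *: e + x]addrC; congr (_ + g _ *: _).
  apply/rowP => i; rewrite !mxE eqxx/=; congr (_ + _ * _).
  by rewrite (inj_eq lift_inj).
pose ga (h : R) := g (col' j x + h *: delta_mx ord0 k).
have S0 : S x = c 0 by rewrite -Sc scale0r add0r.
have dl : is_diff (0 : R) (fun h : R => col' j x + h *: delta_mx ord0 k)
    (fun h : R => 0 + h *: delta_mx ord0 k).
  exact: (is_diffD (is_diff_cst (col' j x : 'rV[R]_n) (0 : R)) (is_diff_scalel (0 : R) (delta_mx ord0 k : 'rV[R]_n))).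
have dg : differentiable g (col' j x + 0 *: delta_mx ord0 k) by exact: (Ck_differentiable Cg).
have dga : is_diff (0 : R) ga (fun h => h * partial k g (col' j x)).
  apply: (is_diff_eq (is_diff_comp dl (differentiableP dg))).
  apply/funext => h /=.
  by rewrite add0r linearZ scale0r addr0 -deriveE// -[X in differentiable _ X]addr0 -(scale0r (delta_mx ord0 k)).
have dc : is_diff (0 : R) c (fun h => 0 + h *: e + (h * partial k g (col' j x)) *: delta_mx ord0 j).
  have dz : is_diff (0 : R) (fun h => ga h *: (delta_mx ord0 j : 'rV[R]_n.+1))
      (fun h => (h * partial k g (col' j x)) *: delta_mx ord0 j).
    apply: DiffDef; first by apply: differentiableZl; exact: ex_diff.
    by rewrite diffZl; [apply/funext => h; rewrite (@diff_val _ _ _ _ _ _ _ dga)|exact: ex_diff].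
  exact: (is_diffD (is_diffD (is_diff_cst x (0 : R)) (is_diff_scalel (0 : R) e)) dz).
have dfc : differentiable f (c 0) by exact: (Ck_differentiable Cf).
have dcf := is_diff_comp dc (differentiableP dfc).
have E : (fun h => h^-1 *: ((shear \o shift x) (h *: e) - shear x)) =
   (fun h => h^-1 *: (((f \o c) \o shift 0) (h *: 1) - (f \o c) 0)).
  by apply/funext => h /=; rewrite /shear Sc S0 addr0 /GRing.scale/= mulr1.
split.
  by rewrite /derivable E; apply: diff_derivable; exact: ex_diff.
rewrite /partial [LHS]/derive E -[LHS]/('D_1 (f \o c) 0) deriveE//.
rewrite (@diff_val _ _ _ _ _ _ _ dcf)/= add0r mul1r scale1r linearD linearZ/= -S0.
by rewrite -!deriveE -/e// S0 // mulrC.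
Qed.


Variable (M : R).
Hypothesis fM : forall x, f x != 0 -> cube M x.

Let partial_fM i x : partial i f x != 0 -> cube M x.
Proof. exact: (partial_off_support fM). Qed.

Let shear_partial_continuous k : continuous (partial (lift j k) shear).
Proof.
rewrite (_ : partial _ _ = fun x => partial (lift j k) f (S x) +
   partial j f (S x) * partial k g (col' j x)); last first.
  by apply/funext => x; case: (shear_partial k x).
apply: continuous_add.
  by apply: continuous_compose; [exact: S_continuous|exact: C1_partial].
apply: continuous_mul.
  by apply: continuous_compose; [exact: S_continuous|exact: C1_partial].
by apply: continuous_compose; [exact: col'_continuous|exact: C1_partial].
Qed.

Let S_cube : exists M', forall x, cube M (S x) -> cube M' x.
Proof.
have [K gK] := @continuous_cube_bounded R n g M (C1_continuous Cg).
exists (M + `|K|) => x Mx.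
have Mc : cube M (col' j x : 'rV[R]_n).
  by move=> i; rewrite mxE; have := Mx (lift j i); rewrite insE2 mxE.
move=> i; have [k ->|->] := unliftP j i.
  by have := Mc k; rewrite mxE => /le_trans; apply; rewrite lerDl.
have := Mx j; rewrite insE1 => h; rewrite -(addrK (g (col' j x)) (x ord0 j)).
by rewrite (le_trans (ler_normB _ _))// lerD// (le_trans (gK _ Mc))// ler_norm.
Qed.

(** The indicator of the half space depends on coordinate j only, hence is constant along lines in
    another coordinate direction, and on each such line a derivative with bounded support integrates
    to 0. *)
Lemma integral_half_shear_partial b k :
  bounded_supp (fun x => half_ray b 0 (x ord0 j) * partial (lift j k) shear x) /\
  \int[lebesgue_rV n.+1]_x (half_ray b 0 (x ord0 j) * partial (lift j k) shear x) = 0.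
Proof.
have [M' SM'] := S_cube.
have sM x : shear x != 0 -> cube M' x by move=> /fM/SM'.
have [K HK] := @continuous_cube_bounded _ _ _ M' (@shear_partial_continuous k).
have bs : bounded_supp (fun x => half_ray b 0 (x ord0 j) * partial (lift j k) shear x).
  apply: (@bounded_suppP _ _ _ K M').
  - apply: measurable_funM; last exact: continuous_measurable.
    by apply: measurable_half_ray => //; exact: measurable_coor.
  - by move=> x; rewrite mulf_eq0 negb_or => /andP[_]; exact: partial_off_support.
  - by move=> x /HK; apply: le_trans; rewrite normrM ler_piMl// half_ray_le1.
split => //; rewrite (Rfubini_rV (lift j k) bs).
rewrite (_ : (fun y => _) = cst 0); first by rewrite Rintegral_cst// mul0r.
apply/funext => z /=.
have cz t : ins (lift j k) t z ord0 j = ins (lift j k) 0 z ord0 j.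
  by rewrite !mxE; case: unliftP => // jl; have := neq_lift j k; rewrite -jl eqxx.
under eq_Rintegral do rewrite cz -derive_ins.
have dS t : derivable (fun s => shear (ins (lift j k) s z)) t 1.
  by apply: derivable_ins; case: (shear_partial k (ins (lift j k) t z)).
have DE : 'D_1 (fun s => shear (ins (lift j k) s z)) =
   (fun t => partial (lift j k) shear (ins (lift j k) t z)).
  by apply/funext => t; rewrite derive_ins.
have cS : continuous ('D_1 (fun s => shear (ins (lift j k) s z))).
  rewrite DE.
  by apply: continuous_compose; [exact: ins_continuous|exact: shear_partial_continuous].
have SS : exists M, forall t, shear (ins (lift j k) t z) != 0 -> `|t| <= M.
  by exists M' => t /sM /(_ (lift j k)); rewrite insE1.
rewrite RintegralZl//; first by rewrite integral_derive0// mulr0.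
apply: bounded_supp1_integrable; rewrite DE; apply: bounded_supp_ins.
apply: (@bounded_suppP _ _ _ K M') => //; first exact: continuous_measurable.
by move=> x; exact: partial_off_support.
Qed.

(** The outward normal before division by [area_factor]; that factor cancels against the density of
    the surface measure. *)
Definition graph_normal b i (y : 'rV[R]_n) : R :=
  side_sign b * (if unlift j i is Some k then - partial k g y else 1).

Let G_continuous : continuous (@graph_point R n.+1 j g).
Proof.
move=> y; apply: continuous_rV => i; have [k ->|->] := unliftP j i.
  rewrite (_ : (fun _ => _) = (fun y : 'rV[R]_n => y ord0 k)).
    exact: coord_continuous.
  by apply/funext => z; rewrite mxE liftK.
rewrite (_ : (fun _ => _) = g); first exact: C1_continuous.
by apply/funext => z; rewrite mxE unlift_none.
Qed.

Lemma graph_normal_continuous b i : continuous (graph_normal b i).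
Proof.
apply: continuous_mul; first exact: cst_continuous.
case: (unlift j i) => [k|]; last exact: cst_continuous.
rewrite (_ : (fun _ => _) = fun y => -1 * partial k g y); last first.
  by apply/funext => y; rewrite mulN1r.
by apply: continuous_mul; [exact: cst_continuous|exact: C1_partial].
Qed.

Lemma bounded_supp_graph b i : bounded_supp (fun y => f (graph_point j g y) * graph_normal b i y).
Proof.
have c : continuous (fun y => f (graph_point j g y) * graph_normal b i y).
  apply: continuous_mul; last exact: graph_normal_continuous.
  by apply: continuous_compose; [exact: G_continuous|exact: C1_continuous].
have [K HK] := @continuous_cube_bounded _ _ _ M c.
apply: (bounded_suppP _ _ HK); first exact: continuous_measurable.
move=> y; rewrite mulf_eq0 negb_or => /andP[/fM h _] k.
by have := h (lift j k); rewrite mxE liftK.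
Qed.

Lemma bounded_supp_half_partial b i :
  bounded_supp (fun x => half_ray b (g (col' j x)) (x ord0 j) * partial i f x).
Proof.
have [K HK] := @continuous_cube_bounded _ _ _ M (C1_partial (i := i) Cf).
apply: (@bounded_suppP _ _ _ K M).
- apply: measurable_funM; last by apply: continuous_measurable; exact: C1_partial.
  apply: measurable_half_ray; last exact: measurable_coor.
  apply: (measurableT_comp (f := g)); last exact: measurable_col'.
  by apply: continuous_measurable; exact: C1_continuous.
- by move=> x; rewrite mulf_eq0 negb_or => /andP[_]; exact: partial_fM.
- by move=> x /HK; apply: le_trans; rewrite normrM ler_piMl// half_ray_le1.
Qed.

Let line_half b y : \int[leb]_t (half_ray b (g y) t * partial j f (ins j t y)) =
  side_sign b * f (graph_point j g y).
Proof.
under eq_Rintegral do rewrite -derive_ins.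
rewrite integral_derive_half_ray//.
- by move=> t; apply: derivable_ins; apply: (Ck_derivable Cf).
- rewrite (_ : 'D_1 (fun s : R => f (ins j s y)) = fun t => partial j f (ins j t y)); last first.
    by apply/funext => t; rewrite derive_ins.
  by apply: continuous_compose; [exact: ins_continuous|exact: C1_partial].
- by exists M => t /fM /(_ j); rewrite insE1.
Qed.

Let half_ray_shift b (a t : R) : half_ray b a (t + a) = half_ray b 0 t.
Proof. by rewrite /half_ray gtrDr ltrDr. Qed.

(** Along axis j this is the fundamental theorem on each line. In another direction, translating
    each line by g y turns the integrand into the derivative of the sheared function, which
    contributes 0, minus the slope of g times the derivative along the axis. *)
Lemma integral_half_partial b i :
  \int[lebesgue_rV n.+1]_x (half_ray b (g (col' j x)) (x ord0 j) * partial i f x) =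
  \int[lebesgue_rV n]_y (f (graph_point j g y) * graph_normal b i y).
Proof.
have bs := bounded_supp_half_partial b i.
rewrite (Rfubini_rV j bs).
under eq_Rintegral do under eq_Rintegral do rewrite insE1 col'_ins.
rewrite /graph_normal; case: unliftP => [k ->|->]; last first.
  by apply: eq_Rintegral => y _; rewrite line_half mulr1 mulrC.
have [bsh ish] := integral_half_shear_partial b k.
(* Inserts the vanishing integral of the sheared derivative, after which the two sides agree on
   every line. *)
rewrite -[RHS]add0r -ish (Rfubini_rV j bsh).
have i1 := bounded_supp_integrable (bounded_supp_Rintegral j bsh).
have i2 := bounded_supp_integrable (bounded_supp_graph b (lift j k)).
rewrite /graph_normal liftK in i2.
rewrite -RintegralD//.
apply: eq_Rintegral => y _.
have b1 i' : bounded_supp1 (fun t => half_ray b (g y) t * partial i' f (ins j t y)).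
  rewrite (_ : (fun _ => _) = fun t => (fun x => half_ray b (g (col' j x)) (x ord0 j) *
    partial i' f x) (ins j t y)).
    exact: (bounded_supp_ins j y (bounded_supp_half_partial b i')).
  by apply/funext => t; rewrite insE1 col'_ins.
have s1 i' := bounded_supp1_integrable (bounded_supp1_shift (g y) (b1 i')).
have b2 := bounded_supp1_integrable (bounded_supp_ins j y bsh).
(* The boundary value is turned back into an integral along the line, so that all three terms can be
   compared under one integral sign. *)
have -> : f (graph_point j g y) * (side_sign b * - partial k g y) =
   - partial k g y * \int[leb]_t (half_ray b (g y) t * partial j f (ins j t y)).
  by rewrite line_half; ring.
rewrite (integral_shift (g y) (b1 (lift j k))) (integral_shift (g y) (b1 j)).
rewrite -RintegralZl// -RintegralD//; last first.
  have := integrableZl measurableT (- partial k g y) (s1 j).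
  by apply: eq_integrable => // t _; rewrite /= EFinM.
apply: eq_Rintegral => t _; rewrite insE1 half_ray_shift.
by rewrite (proj2 (shear_partial k (ins j t y))) /S insE1 col'_ins; ring.
Qed.

End shear.

(** * Surface integrals in one chart *)

Section surface.
Context {R : realType} {n : nat}.
Notation leb := (@lebesgue_measure R).
Variables (Omega : set 'rV[R]_n.+1) (sigma : {measure set 'rV[R]_n.+1 -> \bar R}).
Hypothesis ssigma : surface_measure Omega sigma.
Variables (p : 'rV[R]_n.+1) (r : R) (j : 'I_n.+1) (below : bool) (g : 'rV[R]_n -> R).
Hypothesis chart : @C1_chart R n.+1 Omega p r j below g.

Let Cg : Ck 1 [set: 'rV[R]_n] g. Proof. by case: chart. Qed.
Let r0 : 0 < r. Proof. by case: chart. Qed.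
Let G := @graph_point R n.+1 j g.
Let area := @area_factor R n.+1 g.

Lemma area_factor_gt0 y : 0 < area y.
Proof.
rewrite sqrtr_gt0 ltr_pwDl// /sqn /dot sumr_ge0// => i _.
by rewrite -expr2 sqr_ge0.
Qed.

Lemma area_factor_continuous : continuous area.
Proof.
apply: (@continuous_compose _ _ _ (fun y => 1 + sqn (grad g y)) (@Num.sqrt R));
  last exact: sqrt_continuous.
apply: continuous_add; first exact: cst_continuous.
rewrite /sqn /dot; apply: continuous_sum => i.
apply: (@continuous_mul _ _ (fun x => grad g x ord0 i) (fun x => grad g x ord0 i));
  rewrite (_ : (fun x => _) = partial i g); (try exact: C1_partial);
  by apply/funext => z; rewrite mxE.
Qed.

Let marea : measurable_fun setT area.
Proof. by apply: continuous_measurable; exact: area_factor_continuous. Qed.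

Let mG : measurable_fun setT G.
Proof.
apply: (@measurable_ins _ _ _ n j g id) => //.
by apply: continuous_measurable; exact: C1_continuous.
Qed.

(** A point outside the chart ball, at sup-norm distance exactly r from p, to receive everything
    that must carry no weight in the ball. *)
Let q : 'rV[R]_n.+1 := p + const_mx r.
Let q_ball : ~ ball p r q.
Proof.
move=> /(rV_ball _ _ r0) /(_ ord0).
by rewrite !mxE opprD addNKr normrN gtr0_norm// ltxx.
Qed.

(** Over y, a segment of length [area y] is sent to the graph point and the rest to [q]. The density
    thus becomes a length, and inside the ball sigma is the image under [phi] of a product of
    Lebesgue measures. *)
Let phi (z : 'rV[R]_n * measurableTypeR R) : 'rV[R]_n.+1 :=
  if (0 <= z.2) && (z.2 <= area z.1) then G z.1 else q.

Let mphi : measurable_fun setT phi.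
Proof.
apply: measurable_fun_ifT => //.
- apply: measurable_and; apply: measurable_fun_ler => //.
  by apply: measurableT_comp.
- exact: measurableT_comp.
Qed.

Local Open Scope ereal_scope.

Let phi_section (h : 'rV[R]_n.+1 -> \bar R) y : h q = 0 ->
  measurable_fun setT h -> (forall x, 0 <= h x) ->
  \int[leb]_t h (phi (y, t)) = h (G y) * (area y)%:E.
Proof.
move=> hq mh h0.
transitivity (\int[leb]_(t in `[0%R, area y]) cst (h (G y)) t).
  rewrite [RHS]integral_mkcond; apply: eq_integral => t _.
  rewrite patchE mem_setE in_itv/= /phi /=; case: ifP => //.
rewrite integral_cst//; congr (_ * _).
have := @lebesgue_measure_itv R `[0%R, area y].
by rewrite /= lte_fin area_factor_gt0 sube0 => <-.
Qed.

Let sigmaE A : measurable A -> A `<=` ball p r ->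
  sigma A = pushforward (lebesgue_rV n \x leb) phi A.
Proof.
move=> mA Ap; have [_ h] := ssigma; rewrite (h _ _ _ _ _ chart A)//.
have mpA : measurable (phi @^-1` A).
  by rewrite -[X in measurable X]setTI; exact: mphi.
transitivity (\int[lebesgue_rV n \x leb]_z (\1_(phi @^-1` A) z)%:E); last first.
  by rewrite integral_indic// setIT.
rewrite fubini_tonelli1//; last by apply/measurable_EFinP; exact: measurable_indic.
rewrite integral_mkcond; apply: eq_integral => y _.
rewrite /fubini_F -[RHS]/(\int[leb]_t (\1_A (phi (y, t)))%:E).
rewrite (@phi_section (fun x => (\1_A x)%:E))//.
- rewrite patchE indicE; have [GA|GA] := pselect (A (G y)).
    by rewrite !mem_set// mul1e.
  by rewrite !memNset// mul0e.
- by rewrite indicE memNset// => /Ap.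
- by apply/measurable_EFinP; exact: measurable_indic.
Qed.

Lemma ge0_integral_chart (h : 'rV[R]_n.+1 -> \bar R) : measurable_fun setT h ->
  (forall x, 0 <= h x) -> (forall x, ~ ball p r x -> h x = 0) ->
  \int[sigma]_x h x = \int[lebesgue_rV n]_y (h (G y) * (area y)%:E).
Proof.
move=> mh h0 hB.
have mB : measurable (ball p r) by exact: measurable_rV_ball.
transitivity (\int[sigma]_(x in ball p r) h x).
  rewrite [RHS]integral_mkcond; apply: eq_integral => x _.
  by rewrite patchE; case: ifPn => // /negP xB; rewrite hB// => /mem_set.
rewrite (eq_measure_integral (pushforward (lebesgue_rV n \x leb) phi)); last first.
  by move=> A mA AB; exact: sigmaE.
rewrite (ge0_integral_pushforward mphi)//; last exact: measurable_funTS.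
transitivity (\int[lebesgue_rV n \x leb]_z (h \o phi) z).
  rewrite integral_mkcond; apply: eq_integral => z _.
  rewrite patchE; have [zB|zB] := pselect (ball p r (phi z)).
    by rewrite mem_set.
  by rewrite memNset//= hB.
rewrite fubini_tonelli1; [|exact: (measurableT_comp mh mphi)|by move=> z; exact: h0].
by apply: eq_integral => y _; rewrite /fubini_F /= phi_section// hB.
Qed.

Lemma integral_chart (H : 'rV[R]_n.+1 -> R) : measurable_fun setT H ->
  (forall x, ~ ball p r x -> H x = 0%R) ->
  bounded_supp (fun y => H (G y) * area y)%R ->
  sigma.-integrable setT (EFin \o H) /\
  (\int[sigma]_x H x = \int[lebesgue_rV n]_y (H (G y) * area y))%R.
Proof.
move=> mH HB /bounded_supp_integrable iHG.
have mEH : measurable_fun setT (EFin \o H) by exact/measurable_EFinP.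
split.
  apply/integrableP; split => //.
  rewrite ge0_integral_chart//; first last.
  - by move=> x /HB /= ->; rewrite normr0.
  - exact: measurableT_comp.
  have /integrableP[_] := iHG.
  congr (_ < _); apply: eq_integral => y _ /=.
  by rewrite normrM EFinM (gtr0_norm (area_factor_gt0 y)).
congr fine; rewrite integralE [RHS]integralE; congr (_ - _).
- rewrite ge0_integral_chart//; first last.
  + by move=> x /HB; rewrite funeposE /= => ->; rewrite maxxx.
  + exact: measurable_funepos.
  apply: eq_integral => y _; rewrite !funeposE /= EFinM.
  by rewrite maxe_pMl ?mul0e// lee_fin ltW// area_factor_gt0.
- rewrite ge0_integral_chart//; first last.
  + by move=> x /HB; rewrite funenegE /= => ->; rewrite oppr0 maxxx.
  + exact: measurable_funeneg.
  apply: eq_integral => y _; rewrite !funenegE /= -mulNr EFinM.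
  by rewrite maxe_pMl ?mul0e// lee_fin ltW// area_factor_gt0.
Qed.

End surface.

(** * Divergence theorem for functions supported in one ball *)

Section gauss_green_local.
Context {R : realType} {n : nat}.
Variables (Omega : set 'rV[R]_n.+1) (sigma : {measure set 'rV[R]_n.+1 -> \bar R})
  (nu : 'rV[R]_n.+1 -> 'rV[R]_n.+1).
Hypotheses (oOmega : open Omega) (ssigma : surface_measure Omega sigma)
  (onu : outward_unit_normal Omega nu).

(** The two integrabilities belong to the property because they make it additive in f, as the
    splitting by bump functions requires. *)
Definition gauss_green (i : 'I_n.+1) (f : 'rV[R]_n.+1 -> R) :=
  [/\ (lebesgue_rV n.+1).-integrable Omega (EFin \o partial i f),
      sigma.-integrable (boundary Omega) (EFin \o (fun x => f x * nu x ord0 i)) &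
      \int[lebesgue_rV n.+1]_(x in Omega) partial i f x =
      \int[sigma]_(x in boundary Omega) (f x * nu x ord0 i)].

Let mOmega : measurable Omega. Proof. exact: open_measurable_rV. Qed.

Lemma measurable_boundary : measurable (boundary Omega).
Proof.
apply: measurableD; last by apply: open_measurable_rV; exact: open_interior.
rewrite -[X in measurable X]setCK; apply: measurableC; apply: open_measurable_rV.
by apply: closed_openC; exact: closed_closure.
Qed.

Variables (p : 'rV[R]_n.+1) (r r' : R) (f : 'rV[R]_n.+1 -> R).
Hypotheses (r'r : r' < r) (Cf : Ck 1 setT f)
  (fr : forall x, f x != 0 -> forall i, `|p ord0 i - x ord0 i| <= r').

Let fM : exists M, forall x, f x != 0 -> cube M x.
Proof.
have [K HK] : exists K, forall i, `|p ord0 i| <= K.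
  exists (\sum_i `|p ord0 i|) => i; rewrite (bigD1 i)//= lerDl.
  by apply: sumr_ge0.
exists (K + r') => x /fr fx i; rewrite -(subKr (p ord0 i) (x ord0 i)).
by rewrite (le_trans (ler_normB _ _))// lerD.
Qed.

Let fB x : ~ ball p r x -> f x = 0.
Proof.
apply: contra_notP => /eqP /fr fx.
have r'0 : 0 <= r' by apply: le_trans (fx ord0).
by apply/rV_ball => [|i]; [exact: le_lt_trans r'r|exact: le_lt_trans (fx i) r'r].
Qed.

(** The support lies in a closed cube of half-width [r'], strictly inside the open ball of radius r,
    so the derivatives vanish outside the ball as well. *)
Let partial_fB i x : ~ ball p r x -> partial i f x = 0.
Proof.
pose A := [set x : 'rV[R]_n.+1 | forall i, `|p ord0 i - x ord0 i| <= r'].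
have cA : closed A.
  rewrite (_ : A = (fun x => p - x) @^-1` cube r').
    apply: preimage_closed; last exact: closed_cube.
    move=> z _; apply: continuousB; first exact: cst_continuous.
    by move=> ?.
  by apply/seteqP; split=> z h k; have := h k; rewrite !mxE.
apply: contra_notP => /eqP /(partial_off_closed cA fr) fx.
have r'0 : 0 <= r' by apply: le_trans (fx ord0).
by apply/rV_ball => [|k]; [exact: le_lt_trans r'r|exact: le_lt_trans (fx k) r'r].
Qed.

Lemma gauss_green_chart j below g i : @C1_chart R n.+1 Omega p r j below g ->
  gauss_green i f.
Proof.
move=> chart; have [r0 Cg HO] := chart; have [M HM] := fM.
(* Inside the ball the chart identifies Omega with one side of the graph; outside it both sides
   vanish with the derivative. *)
have E : (partial i f) \_ Omega = (fun x => half_ray below (g (col' j x)) (x ord0 j) * partial i f x).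
  apply/funext => x; rewrite patchE.
  have [Bx|nBx] := pselect (ball p r x); last first.
    by rewrite (partial_fB i nBx) mulr0; case: ifP.
  have hO := HO x Bx; have [Ox|nO] := pselect (Omega x).
    by rewrite mem_set// /half_ray; move: Ox => /hO; case: (below) => ->; rewrite mul1r.
  rewrite memNset// /half_ray (_ : (if below then _ else _) = false) ?mul0r//.
  by apply/negP => h; apply: nO; apply/hO; move: h; case: (below).
have bs := bounded_supp_half_partial j Cf Cg HM below i.
have area0 y : @area_factor R n.+1 g y != 0 by rewrite gt_eqF// (area_factor_gt0 g).
have cnE x : chart_normal j below g x ord0 i =
    (@area_factor R n.+1 g (col' j x))^-1 * graph_normal g j below i (col' j x).
  rewrite !mxE /graph_normal /side_sign -mulrA mulrCA; congr (_ * (_ * _)).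
have mcn : measurable_fun setT (fun x => chart_normal j below g x ord0 i).
  under eq_fun do rewrite cnE.
  apply: continuous_measurable.
  apply: (@continuous_compose _ _ _ (fun x : 'rV[R]_n.+1 => col' j x : 'rV[R]_n)
    (fun y => (@area_factor R n.+1 g y)^-1 * graph_normal g j below i y)).
    exact: col'_continuous.
  apply: continuous_mul; last exact: graph_normal_continuous.
  by apply: continuous_inv => //; exact: (area_factor_continuous chart).
pose H x := f x * chart_normal j below g x ord0 i.
have mH : measurable_fun setT H.
  by apply: measurable_funM => //; apply: continuous_measurable; exact: C1_continuous.
have HG y : H (@graph_point R n.+1 j g y) * area_factor g y =
    f (@graph_point R n.+1 j g y) * graph_normal g j below i y.
  rewrite /H cnE (_ : col' j _ = y); last exact: (col'_ins j (g y) y).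
  by rewrite -mulrA [_^-1 * _]mulrC mulfVK.
have HGs : bounded_supp (fun y : 'rV[R]_n => H (@graph_point R n.+1 j g y) * @area_factor R n.+1 g y).
  rewrite (_ : (fun y => _) = (fun y => f (@graph_point R n.+1 j g y) * graph_normal g j below i y)).
    exact: (bounded_supp_graph j Cf Cg HM below i).
  by apply/funext => y; exact: HG.
have H0 x : ~ ball p r x -> H x = 0 by move=> /fB fx; rewrite /H fx mul0r.
have [iH eH] := integral_chart ssigma chart mH H0 HGs.
have Hnu : {in boundary Omega, H =1 (fun x => f x * nu x ord0 i)}.
  move=> x /set_mem bx; have [Bx|/fB fx] := pselect (ball p r x).
    by rewrite /H (onu chart bx Bx).
  by rewrite /H fx !mul0r.
have mb := measurable_boundary.
split.
- apply/(integrable_mkcond _ mOmega).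
  by rewrite restrict_EFin E; exact: bounded_supp_integrable.
- apply: (@eq_integrable _ _ _ sigma (boundary Omega) mb (EFin \o H)).
    by move=> x /Hnu /= ->.
  exact: integrableS iH.
rewrite Rintegral_mkcond E (integral_half_partial j Cf Cg HM).
under eq_Rintegral do rewrite -HG.
rewrite -eH -(eq_Rintegral _ Hnu) /Rintegral.
(* The complement of the boundary is sigma-null, so the integral of [H] over the whole space is the
   one over the boundary. *)
rewrite (@negligible_integral _ _ _ sigma setT (~` boundary Omega))//.
- by rewrite setTD setCK.
- exact: measurableC.
- by case: ssigma.
Qed.

Lemma gauss_green_interior i : 0 < r -> ball p r `<=` Omega -> gauss_green i f.
Proof.
move=> r0 BO; have [M HM] := fM.
have mb := measurable_boundary.
have M0 : bounded_supp (partial i f).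
  have [K HK] := @continuous_cube_bounded _ _ _ M (C1_partial (i := i) Cf).
  apply: (@bounded_suppP _ _ _ K M) => //.
    by apply: continuous_measurable; exact: C1_partial.
  by move=> x; exact: partial_off_support.
have E : (partial i f) \_ Omega = partial i f.
  apply/funext => x; rewrite patchE; case: ifPn => // /negP xO.
  by rewrite (@partial_fB i x)// => /BO/mem_set.
have f0 : {in boundary Omega, (fun x => f x * nu x ord0 i) =1 cst 0}.
  move=> x /set_mem[_]; rewrite ((interior_id _).1 oOmega) => nO.
  by rewrite fB ?mul0r// => /BO.
split.
- by apply/(integrable_mkcond _ mOmega); rewrite restrict_EFin E; exact: bounded_supp_integrable.
- apply: (@eq_integrable _ _ _ sigma (boundary Omega) mb (EFin \o cst 0)).
    by move=> x /f0 /= ->.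
  exact: integrable0.
rewrite (eq_Rintegral _ f0) Rintegral_cst// mul0r Rintegral_mkcond E.
(* The constant graph at height [M + 1] lies above the support, so integrating under it recovers the
   full integral, and the boundary term is evaluated where f is 0. *)
have Cg : Ck 1 [set: 'rV[R]_n] (cst (M + 1)) by exact: Ck_cst.
transitivity (\int[lebesgue_rV n.+1]_x (half_ray true (cst (M + 1) (col' i x : 'rV[R]_n)) (x ord0 i) * partial i f x)).
  apply: eq_Rintegral => x _; rewrite /half_ray /=; case: ifPn => c; first by rewrite mul1r.
  rewrite mul0r; apply/eqP; apply: contraNT c => /(partial_off_support HM) /(_ i).
  by rewrite ler_norml => /andP[_ h]; rewrite (le_lt_trans h)// ltrDl.
rewrite (integral_half_partial i Cf Cg HM).
rewrite (_ : (fun y => _) = cst 0); first by rewrite Rintegral_cst// mul0r.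
apply/funext => y /=; rewrite [f _](_ : _ = 0) ?mul0r//.
apply/eqP/negP => /negP /HM /(_ i); rewrite mxE unlift_none ler_norml => /andP[_].
by rewrite leNgt ltrDl ltr01.
Qed.

End gauss_green_local.

(** * Plateau functions *)

Section bump.
Context {R : realType}.

(** The truncated square is C^1 with derivative 2 max(0, t), which is all the smoothness the bump
    functions need. *)
Definition sqpos (t : R) : R := Num.max 0 t ^+ 2.

Lemma is_derive_sqpos (t : R) : is_derive t 1 sqpos (2 * Num.max 0 t).
Proof.
have [t0|t0|<-] := ltgtP 0 t.
- apply: (@near_eq_is_derive R R R (fun s : R => s ^+ 2 : R) sqpos t 1).
    have : \forall s \near t, 0 < s by exact: lt_nbhsr.
    by apply: filterS => s s0; rewrite /sqpos max_r ?ltW.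
  have := @is_deriveX R _ id 2 t 1 1 (is_derive_id _ _).
  by rewrite /GRing.scale/= expr1 mulr1.
- rewrite mulr0.
  apply: (@near_eq_is_derive R R R (cst (0 : R)) sqpos t 1).
  have : \forall s \near t, s < 0 by exact: lt_nbhsl.
  by apply: filterS => s s0; rewrite /sqpos max_l ?ltW// expr0n.
- rewrite mulr0.
  have h : (fun h : R => h^-1 *: ((sqpos \o shift (0 : R)) (h *: (1 : R)) - sqpos 0)) @ 0^' --> (0 : R).
    apply/cvgrPdist_le => e e0; near=> h.
    have h0 : h != 0 by near: h; exact: nbhs_dnbhs_neq.
    have he : `|h| <= e by near: h; exact: dnbhs0_le.
    rewrite sub0r normrN /= addr0 /GRing.scale/= mulr1 /sqpos maxxx expr0n subr0 normrM normfV.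
    rewrite ler_pdivrMl ?normr_gt0// normrX expr2.
    have hm : `|Num.max 0 h| <= `|h| by case: (leP 0 h) => //; rewrite ?normr0 ?normr_ge0.
    by rewrite ler_pM// (le_trans hm).
  by apply: DeriveDef; [apply/cvg_ex; exists 0|apply/cvg_lim].
Unshelve. all: by end_near. Qed.

Lemma Ck1_sqpos (V : normedModType R) (U : set V) (f : V -> R) : open U ->
  Ck 1 U f -> Ck 1 U (fun x => sqpos (f x)).
Proof.
move=> oU Cf.
apply: (@Ck_comp_step _ _ _ _ _ sqpos (fun t => 2 * Num.max 0 t)) => //.
  by move=> x _; exact: is_derive_sqpos.
move=> x Ux /=; apply: continuousM; first exact: cst_continuous.
have cf := Ck_continuous Cf Ux.
by apply: continuous_max => //; exact: cst_continuous.
Qed.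

Lemma Ck_coord n k i : Ck k setT (fun x : 'rV[R]_n => x ord0 i).
Proof.
case: k => [|k]; first by move=> x _; exact: coord_continuous.
split=> [x _|v]; first exact: differentiable_coord.
apply: Ck_eq (Ck_cst k setT (v ord0 i)); first exact: openT.
move=> x _ /=; rewrite /derive; apply/esym/cvg_lim => //.
apply: cvg_near_cst; near=> h.
rewrite /= !mxE addrK scalerA mulVf ?scale1r//.
by near: h; exact: nbhs_dnbhs_neq.
Unshelve. all: by end_near. Qed.

Variables (n : nat) (p : 'rV[R]_n) (r : R).
Hypothesis r0 : 0 < r.

Let s (x : 'rV[R]_n) := sqn (x - p).

(** The inner argument is at most 0 when |x - p|^2 is at most r^2 / 8 and at least 1 from r^2 / 4
    on. The Euclidean square is used because it is polynomial in x; the Euclidean ball of radius r /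
    2 lies inside the cube [ball p r]. *)
Definition bump (x : 'rV[R]_n) : R :=
  sqpos (1 - sqpos (8 / r ^+ 2 * (sqn (x - p) - r ^+ 2 / 8))).

Let C1s k : Ck k setT s.
Proof.
have oT := @openT 'rV[R]_n.
apply: Ck_sum => // i.
have Ci : Ck k setT (fun x : 'rV[R]_n => x ord0 i - p ord0 i).
  by apply: Ck_B => //; [exact: Ck_coord|exact: Ck_cst].
apply: Ck_eq (Ck_M oT Ci Ci) => // x _.
by rewrite !mxE.
Qed.

Lemma C1_bump : Ck 1 setT bump.
Proof.
have oT := @openT 'rV[R]_n.
have Ci := Ck_M oT (Ck_cst 1 setT (8 / r ^+ 2)) (Ck_B oT (C1s 1) (Ck_cst 1 setT (r ^+ 2 / 8))).
exact: (Ck1_sqpos oT (Ck_B oT (Ck_cst 1 setT 1) (Ck1_sqpos oT Ci))).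
Qed.

Lemma open_bump_nbhs : open [set x | s x < r ^+ 2 / 8].
Proof.
apply: (@open_comp _ _ s [set t | t < r ^+ 2 / 8]); last exact: open_lt.
by move=> x _; exact: (Ck_continuous (C1s 0)).
Qed.

Lemma bump1 x : sqn (x - p) < r ^+ 2 / 8 -> bump x = 1.
Proof.
move=> h; rewrite /bump /sqpos [Num.max 0 (_ * _)]max_l.
  by rewrite expr0n subr0 max_r// expr1n.
by rewrite pmulr_rle0 ?subr_le0 ?ltW// divr_gt0// exprn_gt0.
Qed.

Lemma bump_center : sqn (p - p) < r ^+ 2 / 8.
Proof.
rewrite subrr /sqn /dot big1 ?divr_gt0 ?exprn_gt0// => i _.
by rewrite mxE mul0r.
Qed.

Lemma bump0 x : r ^+ 2 / 4 <= sqn (x - p) -> bump x = 0.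
Proof.
move=> h; have r2 : 0 < r ^+ 2 by rewrite exprn_gt0.
have h1 : 1 <= 8 / r ^+ 2 * (sqn (x - p) - r ^+ 2 / 8).
  by rewrite mulrAC ler_pdivlMr// mul1r; lra.
rewrite /bump /sqpos [Num.max 0 (_ * _)]max_r; last by rewrite (le_trans _ h1).
by rewrite max_l ?expr0n// subr_le0 expr_ge1// (le_trans _ h1).
Qed.

Lemma open_bump0 : open [set x | r ^+ 2 / 4 < s x].
Proof.
apply: (@open_comp _ _ s [set t | r ^+ 2 / 4 < t]); last exact: open_gt.
by move=> x _; exact: (Ck_continuous (C1s 0)).
Qed.

Lemma bump_supp x : sqn (x - p) <= r ^+ 2 / 4 -> forall i, `|p ord0 i - x ord0 i| <= r / 2.
Proof.
move=> h i; rewrite distrC -ler_sqr ?nnegrE ?normr_ge0 ?divr_ge0 ?(ltW r0)//.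
rewrite real_normK ?num_real// exprMn (_ : (2^-1) ^+ 2 = 4^-1); last by field.
rewrite (le_trans _ h)// /sqn /dot (bigD1 i)//= !mxE expr2 lerDl sumr_ge0// => k _.
by rewrite -expr2 sqr_ge0.
Qed.

End bump.

(** * Divergence theorem on the whole domain *)

Section gauss_green_global.
Context {R : realType} {n : nat}.
Variables (Omega : set 'rV[R]_n.+1) (sigma : {measure set 'rV[R]_n.+1 -> \bar R})
  (nu : 'rV[R]_n.+1 -> 'rV[R]_n.+1).
Hypotheses (dOmega : @bounded_C1_domain R n.+1 Omega) (ssigma : surface_measure Omega sigma)
  (onu : outward_unit_normal Omega nu).
Variables (U : set 'rV[R]_n.+1) (i : 'I_n.+1).
Hypotheses (oU : open U) (OU : closure Omega `<=` U).

Let oOmega : open Omega. Proof. by case: dOmega. Qed.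
Let mOmega : measurable Omega. Proof. exact: open_measurable_rV. Qed.
Let mb := @measurable_boundary R n Omega.

Lemma subOU x : Omega x -> U x.
Proof. by move=> Ox; apply: OU; exact: subset_closure. Qed.

Lemma compact_closure_domain : compact (closure Omega).
Proof.
apply: bounded_closed_compact; last exact: closed_closure.
have [_ _ _ [M [Mr HM]] _] := dOmega.
exists M; split => // K MK x cx.
have : closed [set x : 'rV[R]_n.+1 | `|x| <= K].
  apply: (@preimage_closed _ _ (fun x : 'rV[R]_n.+1 => `|x|) [set t | t <= K]); last exact: closed_le.
  by move=> z _; exact: norm_continuous.
by move=> /closure_id ->; apply: closureS cx => z /(HM _ MK).
Qed.

Definition good_ball (p : 'rV[R]_n.+1) r := [/\ 0 < r, ball p r `<=` U &
  ball p r `<=` Omega \/ exists j below g, @C1_chart R n.+1 Omega p r j below g].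

Lemma good_ballP p : closure Omega p -> exists r, good_ball p r.
Proof.
move=> cp; have /nbhs_ballP[e /= e0 peU] : nbhs p U by apply: open_nbhs_nbhs; split => //;
  exact: OU.
have [Op|nOp] := pselect (Omega p).
  have /nbhs_ballP[e' /= e'0 pe'] : nbhs p Omega by exact: open_nbhs_nbhs.
  exists (Num.min e e'); split; first by rewrite lt_min e0.
    by apply: subset_trans peU; apply: le_ball; rewrite ge_min lexx.
  by left; apply: subset_trans pe'; apply: le_ball; rewrite ge_min lexx orbT.
have [_ _ _ _ H] := dOmega.
have bp : boundary Omega p by split => //; rewrite ((interior_id _).1 oOmega).
have [r [j [b [g [r0 Cg Hr]]]]] := H _ bp.
exists (Num.min e r); split; first by rewrite lt_min e0.
  by apply: subset_trans peU; apply: le_ball; rewrite ge_min lexx.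
right; exists j, b, g; split => //; first by rewrite lt_min e0.
by move=> x px; apply: Hr; apply: le_ball px; rewrite ge_min lexx orbT.
Qed.

(** f is C^1 only on U. The product is C^1 everywhere because it is C^1 on the ball and identically
    0 on the open set where |x - p|^2 exceeds r^2 / 4, and these two sets cover the space. *)
Lemma gauss_green_bump p r f : good_ball p r -> Ck 1 U f ->
  gauss_green Omega sigma nu i (fun x => bump p r x * f x).
Proof.
move=> [r0 BU Bo] Cf.
have r2r : r / 2 < r by rewrite ltr_pdivrMr// ltr_pMr// ltr1n.
have supp x : bump p r x * f x != 0 -> sqn (x - p) <= r ^+ 2 / 4.
  by rewrite leNgt; apply: contraNN => /ltW h; rewrite bump0// mul0r.
have fr x : bump p r x * f x != 0 -> forall i, `|p ord0 i - x ord0 i| <= r / 2.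
  by move=> /supp; exact: bump_supp.
have CF : Ck 1 setT (fun x => bump p r x * f x).
  apply: (@Ck_local _ _ _ (ball p r) [set x | r ^+ 2 / 4 < sqn (x - p)]).
  - apply: Ck_M; first exact: ball_open.
      exact: Ck_sub (C1_bump p r).
    exact: Ck_sub Cf.
  - apply: Ck_eq (Ck_cst 1 _ 0); first exact: open_bump0.
    by move=> x /= /ltW h; rewrite bump0// mul0r.
  - move=> x; have [h|h] := leP (sqn (x - p)) (r ^+ 2 / 4); last by right.
    by left; apply/rV_ball => // k; rewrite (le_lt_trans (bump_supp r0 h k)).
case: Bo => [BO|[j [b [g chart]]]]; first exact: gauss_green_interior r2r CF fr _ r0 BO.
exact: (gauss_green_chart oOmega ssigma onu r2r CF fr _ chart).
Qed.

Lemma gauss_green_add f1 f2 : Ck 1 U f1 -> Ck 1 U f2 ->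
  gauss_green Omega sigma nu i f1 -> gauss_green Omega sigma nu i f2 ->
  gauss_green Omega sigma nu i (fun x => f1 x + f2 x).
Proof.
move=> C1 C2 [i1 s1 e1] [i2 s2 e2].
have E x : Omega x -> partial i (fun x => f1 x + f2 x) x = partial i f1 x + partial i f2 x.
  by move=> /subOU Ux; apply: deriveD; [exact: Ck_derivable C1 Ux|exact: Ck_derivable C2 Ux].
have Es x : (f1 x + f2 x) * nu x ord0 i = f1 x * nu x ord0 i + f2 x * nu x ord0 i.
  exact: mulrDl.
split.
- apply: eq_integrable (integrableD _ i1 i2) => // x /set_mem Ox.
  by rewrite /= E.
- apply: eq_integrable (integrableD _ s1 s2) => // x _.
  by rewrite /= Es.
under eq_Rintegral => x /set_mem Ox do rewrite E//.
under [RHS]eq_Rintegral => x _ do rewrite Es.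
by rewrite !RintegralD// e1 e2.
Qed.

Lemma gauss_green_eq0 f : (forall x, closure Omega x -> f x = 0) ->
  gauss_green Omega sigma nu i f.
Proof.
move=> f0.
have E : {in Omega, partial i f =1 cst 0}.
  move=> x /set_mem Ox; rewrite /partial (@eq_derive_on _ _ Omega f (cst 0))//.
    by rewrite derive_cst.
  by move=> z Oz; apply: f0; exact: subset_closure.
have Es : {in boundary Omega, (fun x => f x * nu x ord0 i) =1 cst 0}.
  by move=> x /set_mem[cx _]; rewrite f0// mul0r.
split.
- apply: (@eq_integrable _ _ _ _ Omega mOmega (EFin \o cst 0)); last exact: integrable0.
  by move=> x /E /= ->.
- apply: (@eq_integrable _ _ _ _ (boundary Omega) mb (EFin \o cst 0)); last exact: integrable0.
  by move=> x /Es /= ->.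
by rewrite (eq_Rintegral _ E) (eq_Rintegral _ Es) !Rintegral_cst// !mul0r.
Qed.

Theorem gauss_green_domain f : Ck 1 U f -> gauss_green Omega sigma nu i f.
Proof.
have [rr Hrr] : exists rr : 'rV[R]_n.+1 -> R, forall p, closure Omega p -> good_ball p (rr p).
  have H p : exists r, closure Omega p -> good_ball p r.
    have [cp|ncp] := pselect (closure Omega p); last by exists 0.
    by have [r Hr] := good_ballP cp; exists r.
  by have [rr Hrr] := choice H; exists rr.
have := compact_closure_domain; rewrite compact_cover.
(* The cover consists of open sets on which the bump functions equal 1, not of their supports: at
   every point of the closure some factor 1 - bump is then 0. *)
move=> /(_ _ (closure Omega) (fun p => [set x | sqn (x - p) < (rr p) ^+ 2 / 8])).
case=> [p _|p cp|D DO cov].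
- exact: open_bump_nbhs.
- by exists p => //=; apply: bump_center; case: (Hrr p cp).
move=> Cf.
pose bs (s : seq 'rV[R]_n.+1) x := (\prod_(p <- s) (1 - bump p (rr p) x)) * f x.
have CB p : Ck 1 U (bump p (rr p)) := Ck_sub (@subsetT _ U) (C1_bump p (rr p)).
have Cb s : Ck 1 U (bs s).
  elim: s => [|p s IH].
    by apply: Ck_eq Cf => // x _; rewrite /bs big_nil mul1r.
  apply: (Ck_eq oU _ (Ck_M oU (Ck_B oU (Ck_cst 1 U 1) (CB p)) IH)) => x _.
  by rewrite /bs big_cons mulrA.
(* Removes one factor at a time: [bs s] is [bump p (rr p) * bs s], supported in one good ball, plus
   [bs (p :: s)]. The property descends from the full product to f. *)
have step s : (forall p, p \in s -> closure Omega p) ->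
    gauss_green Omega sigma nu i (bs s) -> gauss_green Omega sigma nu i f.
  elim: s => [_|p s IH sO gg].
    by rewrite (_ : bs [::] = f)//; apply/funext => x; rewrite /bs big_nil mul1r.
  apply: IH => [q qs|]; first by apply: sO; rewrite inE qs orbT.
  have gp : good_ball p (rr p) by apply: Hrr; apply: sO; rewrite inE eqxx.
  have -> : bs s = (fun x => bump p (rr p) x * bs s x + bs (p :: s) x).
    by apply/funext => x; rewrite /bs big_cons; ring.
  exact: (gauss_green_add (Ck_M oU (CB p) (Cb s)) (Cb (p :: s))
    (gauss_green_bump gp (Cb s)) gg).
apply: (step (finmap.enum_fset D)) => [p /DO /set_mem//|].
apply: gauss_green_eq0 => x /cov[p /= pD xp].
have [r0 _ _] := Hrr p (set_mem (DO _ pD)).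
by rewrite /bs (bigD1_seq p) ?finmap.fset_uniq//= (bump1 r0 xp) subrr !mul0r.
Qed.

End gauss_green_global.

(** * Functions of two real variables *)

Section composition2.
Context {R : realType} {V : normedModType R}.

Lemma derive_comp2 (phi : R * R -> R) (f g : V -> R) x v :
  differentiable phi (f x, g x) -> differentiable f x -> differentiable g x ->
  differentiable (fun x => phi (f x, g x)) x /\
  'D_v (fun x => phi (f x, g x)) x =
  'D_(1, 0) phi (f x, g x) * 'D_v f x + 'D_(0, 1) phi (f x, g x) * 'D_v g x.
Proof.
move=> dphi df dg.
have dfg : differentiable (fun x => (f x, g x)) x by exact: differentiable_pair.
have dc : differentiable (phi \o (fun x => (f x, g x))) x by exact: differentiable_comp.
split; first exact: dc.
rewrite (deriveE _ dc) (diff_comp dfg dphi)/= (diff_pair df dg)/= !deriveE//.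
rewrite (_ : ('d f x v, 'd g x v) = 'd f x v *: ((1, 0) : R * R) + 'd g x v *: ((0, 1) : R * R));
  last first.
  by rewrite [RHS](_ : _ = ('d f x v * 1 + 'd g x v * 0, 'd f x v * 0 + 'd g x v * 1))// !mulr1 !mulr0 addr0 add0r.
by rewrite linearD !linearZ/= /GRing.scale/= mulrC [X in _ + X]mulrC.
Qed.

(** A derivative of the composite is a combination of derivatives of f and g whose coefficients are
    ['D_(1, 0) phi] and ['D_(0, 1) phi] composed in the same way; hence the induction on k for all
    phi. *)
Lemma Ck_comp2 k (S : set (R * R)) (U : set V) (phi : R * R -> R) (f g : V -> R) :
  open U -> (forall x, U x -> S (f x, g x)) -> Ck k S phi -> Ck k U f -> Ck k U g ->
  Ck k U (fun x => phi (f x, g x)).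
Proof.
move=> oU fS; elim: k phi => [|k IH] phi.
  move=> cphi cf cg x Ux.
  have c : {for x, continuous (fun x => (f x, g x))}.
    exact: (cvg_pair (cf x Ux) (cg x Ux)).
  exact: (continuous_comp c (cphi _ (fS x Ux))).
move=> [dphi Dphi] /[dup] Cf [df Df] /[dup] Cg [dg Dg].
have H x v (Ux : U x) := derive_comp2 v (dphi _ (fS _ Ux)) (df _ Ux) (dg _ Ux).
split=> [x Ux|v]; first exact: (proj1 (H x 0 Ux)).
have C1 := Ck_M oU (IH _ (Dphi (1, 0)) (Ck_S Cf) (Ck_S Cg)) (Df v).
have C2 := Ck_M oU (IH _ (Dphi (0, 1)) (Ck_S Cf) (Ck_S Cg)) (Dg v).
by apply: Ck_eq (Ck_D oU C1 C2) => // x Ux; rewrite (proj2 (H x v Ux)).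
Qed.

End composition2.

Section two_variables.
Context {R : realType}.
Implicit Types (phi : R -> R -> R).

(** Chemical potentials are derivatives in one variable with the other frozen; as directional
    derivatives on the plane they inherit regularity from the free energy through [Ck]. *)
Lemma derive1_fst phi n T : derive1 (fun m => phi m T) n =
  'D_((1, 0) : R * R) (fun z : R * R => phi z.1 z.2) (n, T).
Proof.
rewrite derive1E /derive; congr (lim (_ @ 0^')); apply/funext => h /=.
by rewrite [h *: (0 : R)]mulr0 add0r.
Qed.

Lemma derive1_snd phi n T : derive1 (fun t => phi n t) T =
  'D_((0, 1) : R * R) (fun z : R * R => phi z.1 z.2) (n, T).
Proof.
rewrite derive1E /derive; congr (lim (_ @ 0^')); apply/funext => h /=.
by rewrite [h *: (0 : R)]mulr0 add0r.
Qed.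

Lemma Ck_fst k : Ck k setT (fst : R * R -> R).
Proof.
case: k => [|k]; first by move=> z _; exact: cvg_fst.
have df (z : R * R) : is_diff z (fst : R * R -> R) fst.
  have lf : linear (fst : R * R -> R) by [].
  pose fM := GRing.isLinear.Build _ _ _ _ (fst : R * R -> R) lf.
  pose fL : {linear (R * R)%type -> R} := HB.pack (fst : R * R -> R) fM.
  have cf : continuous fL by move=> w; exact: cvg_fst.
  by apply: DiffDef; [exact: (@linear_differentiable _ _ _ fL z)|rewrite (@diff_lin _ _ _ fL z)].
split=> [z _|v]; first by case: (df z).
apply: Ck_eq (Ck_cst k setT v.1); first exact: openT.
by move=> z _; rewrite deriveE; [case: (df z) => _ ->|case: (df z)].
Qed.

Lemma Ck_snd k : Ck k setT (snd : R * R -> R).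
Proof.
case: k => [|k]; first by move=> z _; exact: cvg_snd.
have df (z : R * R) : is_diff z (snd : R * R -> R) snd.
  have lf : linear (snd : R * R -> R) by [].
  pose fM := GRing.isLinear.Build _ _ _ _ (snd : R * R -> R) lf.
  pose fL : {linear (R * R)%type -> R} := HB.pack (snd : R * R -> R) fM.
  have cf : continuous fL by move=> w; exact: cvg_snd.
  by apply: DiffDef; [exact: (@linear_differentiable _ _ _ fL z)|rewrite (@diff_lin _ _ _ fL z)].
split=> [z _|v]; first by case: (df z).
apply: Ck_eq (Ck_cst k setT v.2); first exact: openT.
by move=> z _; rewrite deriveE; [case: (df z) => _ ->|case: (df z)].
Qed.

End two_variables.

(** * Derivative of the oriented integral *)

Section oriented_integral_derive.
Context {R : realType}.
Notation leb := (@lebesgue_measure R).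

(** A base point below both endpoints absorbs the case distinction on their order. *)
Lemma oriented_integralE (h : R -> R) (a s t : R) : a < s -> a < t ->
  (forall x, a <= x -> {for x, continuous h}) ->
  oriented_integral h s t =
  \int[leb]_(x in `[a, t]) h x - \int[leb]_(x in `[a, s]) h x.
Proof.
move=> as_ at_ ch.
have ih x : leb.-integrable `[a, x] (EFin \o h).
  apply: continuous_compact_integrable; first exact: segment_compact.
  apply/continuous_in_subspaceT => z; rewrite inE/= in_itv/= => /andP[az _].
  exact: ch.
have E x y : a < x -> x <= y -> \int[leb]_(z in `[x, y]) h z =
   \int[leb]_(x in `[a, y]) h x - \int[leb]_(x in `[a, x]) h x.
  move=> ax xy; rewrite Rintegral_itvB// ?bnd_simp//; last exact: ltW.
  rewrite Rintegral_itv_obnd_cbnd//; apply: integrableS (ih y) => //.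
  by apply: subset_itvr; rewrite bnd_simp ltW.
rewrite /oriented_integral; case: leP => st; first by rewrite E.
by rewrite E ?ltW// opprB.
Qed.

Lemma is_derive_oriented_integral (h : R -> R) (s t : R) : 0 < s -> 0 < t ->
  (forall x, 0 < x -> {for x, continuous h}) ->
  is_derive t 1 (oriented_integral h s) (h t).
Proof.
move=> s0 t0 ch.
(* Half the smaller endpoint lies strictly below both and stays positive, where the integrand is
   continuous. *)
pose a := Num.min s t / 2.
have m0 : 0 < Num.min s t by rewrite lt_min s0.
have a0 : 0 < a by rewrite divr_gt0.
have am : a < Num.min s t by rewrite ltr_pdivrMr// ltr_pMr// ltr1n.
have as_ : a < s by rewrite (lt_le_trans am)// ge_min lexx.
have at_ : a < t by rewrite (lt_le_trans am)// ge_min lexx orbT.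
have cha x : a <= x -> {for x, continuous h} by move=> ax; apply: ch; exact: lt_le_trans ax.
apply: (@near_eq_is_derive R R R (fun t : R => \int[leb]_(x in `[a, t]) h x -
    \int[leb]_(x in `[a, s]) h x) (oriented_integral h s) t 1).
  have : \forall u \near t, a < u by exact: lt_nbhsr.
  by apply: filterS => u au; rewrite (oriented_integralE as_ au cha).
have [d1 d2] : derivable (fun t => \int[leb]_(x in `[a, t]) h x) t 1 /\
   derive1 (fun t => \int[leb]_(x in `[a, t]) h x) t = h t.
  apply: (@continuous_FTC1_closed _ h a t (t + 1)) => //; first by rewrite ltrDl.
    apply: continuous_compact_integrable; first exact: segment_compact.
    apply/continuous_in_subspaceT => z; rewrite inE/= in_itv/= => /andP[az _].
    exact: cha.
  exact: ch.
rewrite derive1E in d2.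
rewrite -[h t]subr0; apply: is_deriveB; exact: DeriveDef.
Qed.

End oriented_integral_derive.

Ltac Ck_tac oU := repeat first
  [ assumption
  | apply: Ck_cst
  | apply: (Ck_sum oU) => ?
  | apply: (Ck_X _ oU)
  | apply: (Ck_B oU)
  | apply: (Ck_D oU)
  | apply: (Ck_N oU)
  | apply: (Ck_M oU) ].

(** * Regularity of the Peng-Robinson thermodynamic functions *)

Section fluid.
Context {R : realType} (F : pr_fluid R).
Hypotheses (R0 : 0 < Rgas F) (Tc0 : 0 < Tcrit F) (Pc0 : 0 < Pcrit F).

Definition state_space : set (R * R) := [set p | 0 < p.1 < (b_pr F)^-1 /\ 0 < p.2].

Lemma b_pr_gt0 : 0 < b_pr F.
Proof.
rewrite /b_pr mulr_gt0// ?divr_gt0 ?mulr_gt0//.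
by rewrite /dec /=; lra.
Qed.

Lemma T0_gt0 : 0 < T0 :> R.
Proof. by rewrite /T0 /dec /=; lra. Qed.

(** The reference temperature is positive, so no interval of integration meets the singularity of 1
    / tau at 0. *)
Lemma Ck_oriented_integral (V : normedModType R) k (U : set V) (T : V -> R) :
  open U -> (forall x, U x -> 0 < T x) -> Ck k U T ->
  Ck k U (fun x => oriented_integral (fun tau => psi_p F tau / tau) T0 (T x)).
Proof.
move=> oU TU.
pose h tau := psi_p F tau / tau.
have Ch l : Ck l U T -> Ck l U (fun x => h (T x)).
  move=> CT; apply: (Ck_M oU); first by rewrite /psi_p; Ck_tac oU.
  by apply: Ck_V => // x /TU; rewrite lt0r => /andP[].
have ch x : 0 < x -> {for x, continuous h}.
  move=> x0; apply: continuousM.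
    rewrite /psi_p; apply: continuous_sum => i; apply: continuous_mul.
      exact: cst_continuous.
    exact: exprn_continuous.
  by apply: continuousV; [rewrite gt_eqF|].
have dI x : U x -> is_derive (T x) 1 (oriented_integral h T0) (h (T x)).
  by move=> Ux; apply: is_derive_oriented_integral; [exact: T0_gt0|exact: TU|exact: ch].
case: k => [|k] CT; last first.
  by apply: (@Ck_comp_step _ _ _ _ _ (oriented_integral h T0) h) => //; exact/Ch/Ck_S.
move=> x Ux; apply: (@continuous_comp _ _ _ T (oriented_integral h T0)); first exact: CT.
apply: differentiable_continuous; apply/derivable1_diffP.
exact: (@ex_derive _ _ _ _ _ _ _ (dI x Ux)).
Qed.

Section composite.
Context {V : normedModType R}.
Variables (k : nat) (U : set V) (n T : V -> R).
Hypotheses (oU : open U) (Cn : Ck k U n) (CT : Ck k U T)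
  (nU : forall x, U x -> 0 < n x < (b_pr F)^-1) (TU : forall x, U x -> 0 < T x).

Lemma Ck_a_pr : Ck k U (fun x => a_pr F (T x)).
Proof.
rewrite /a_pr; Ck_tac oU.
apply: Ck_sqrt => //; last by Ck_tac oU.
by move=> x /TU Tx; rewrite divr_gt0.
Qed.

Lemma Ck_c_inf : Ck k U (fun x => c_inf F (T x)).
Proof.
apply: (Ck_M oU); last by Ck_tac oU.
by apply: (Ck_M oU); [exact: Ck_a_pr|exact: Ck_cst].
Qed.

Lemma Ck_f_ideal : Ck k U (fun x => f_ideal F (n x) (T x)).
Proof.
rewrite /f_ideal; Ck_tac oU.
  apply: Ck_ln => //.
    move=> x Ux; rewrite divr_gt0 ?exprn_gt0// !mulr_gt0//; last exact: TU.
    by case/andP: (nU Ux).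
  apply: (Ck_M oU); first exact: Ck_cst.
  apply: Ck_V => //; last by Ck_tac oU.
  move=> x Ux; rewrite gt_eqF// !mulr_gt0//; last exact: TU.
  by case/andP: (nU Ux).
exact: Ck_oriented_integral.
Qed.

Lemma Ck_f_repulsion : Ck k U (fun x => f_repulsion F (n x) (T x)).
Proof.
rewrite /f_repulsion; Ck_tac oU.
apply: Ck_ln => //; last by Ck_tac oU.
move=> x /nU/andP[_]; rewrite subr_gt0 -ltr_pdivlMl ?b_pr_gt0// mulr1//.
Qed.

Lemma Ck_f_convex : Ck k U (fun x => f_convex F (n x) (T x)).
Proof. by apply: Ck_D => //; [exact: Ck_f_ideal|exact: Ck_f_repulsion]. Qed.

Lemma Ck_f_concave : Ck k U (fun x => f_concave F (n x) (T x)).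
Proof.
have bn x : U x -> 0 < b_pr F * n x < 1.
  move=> /nU/andP[n0 n1]; rewrite mulr_gt0 ?b_pr_gt0//=.
  by rewrite -ltr_pdivlMl ?b_pr_gt0// mulr1.
(* With 0 < b n < 1 these bounds keep numerator and denominator inside the logarithm positive. *)
have [s0 s2] : 1 < Num.sqrt 2%:R :> R /\ Num.sqrt 2%:R < 2 :> R.
  split; first by rewrite -[ltLHS]sqrtr1 ltr_sqrt// ltr1n.
  rewrite -[ltRHS](@ger0_norm R 2)// -sqrtr_sqr ltr_sqrt ?exprn_gt0//.
  by rewrite expr2; lra.
have d0 x : U x -> 0 < 1 + (1 + Num.sqrt 2%:R) * b_pr F * n x.
  move=> /bn /andP[b0 _]; rewrite -mulrA; nra.
apply: (Ck_M oU).
  apply: (Ck_M oU); last exact: Ck_cst.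
  by apply: (Ck_M oU) => //; exact: Ck_a_pr.
apply: Ck_ln => //.
  move=> x Ux; rewrite divr_gt0 ?d0//.
  by have /andP[b0 b1] := bn x Ux; rewrite -mulrA; nra.
apply: (Ck_M oU); first by Ck_tac oU.
apply: Ck_V => //; last by Ck_tac oU.
by move=> x /d0; rewrite lt0r => /andP[].
Qed.

End composite.
Lemma open_state_space : open state_space.
Proof.
have cf : continuous (fst : R * R -> R) by move=> z; exact: cvg_fst.
have cs : continuous (snd : R * R -> R) by move=> z; exact: cvg_snd.
rewrite (_ : state_space = fst @^-1` [set t | 0 < t] `&` fst @^-1` [set t | t < (b_pr F)^-1]
  `&` snd @^-1` [set t | 0 < t]).
  apply: openI; first apply: openI.
  - by apply: open_comp; [move=> z _; exact: cf|exact: open_gt].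
  - by apply: open_comp; [move=> z _; exact: cf|exact: open_lt].
  - by apply: open_comp; [move=> z _; exact: cs|exact: open_gt].
apply/seteqP; split=> z; first by move=> [/andP[? ?] ?].
by move=> [[/= ? ?] ?]; split => //; apply/andP.
Qed.

Let Cfst k : Ck k state_space (fst : R * R -> R).
Proof. by apply: Ck_sub (Ck_fst k). Qed.
Let Csnd k : Ck k state_space (snd : R * R -> R).
Proof. by apply: Ck_sub (Ck_snd k). Qed.
Let S1 z : state_space z -> 0 < z.1 < (b_pr F)^-1. Proof. by case. Qed.
Let S2 z : state_space z -> 0 < z.2. Proof. by case. Qed.

(** [f_convex] is of every class on the state space, so the derivative taken here costs no
    regularity. *)
Lemma Ck_mu_convex k : Ck k state_space (fun z => mu_convex F z.1 z.2).
Proof.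
rewrite (_ : (fun z => _) = 'D_(1, 0) (fun z : R * R => f_convex F z.1 z.2)).
  have [_] := @Ck_f_convex _ k.+1 _ _ _ open_state_space (Cfst _) (Csnd _) S1 S2.
  exact.
by apply/funext => -[n T]; exact: derive1_fst.
Qed.

Lemma Ck_mu_convex_n k : Ck k state_space (fun z => mu_convex_n F z.1 z.2).
Proof.
rewrite (_ : (fun z => _) = 'D_(1, 0) (fun z : R * R => mu_convex F z.1 z.2)).
  by have [_] := Ck_mu_convex k.+1; exact.
by apply/funext => -[n T]; exact: derive1_fst.
Qed.

Lemma Ck_mu_concave k : Ck k state_space (fun z => mu_concave F z.1 z.2).
Proof.
rewrite (_ : (fun z => _) = 'D_(1, 0) (fun z : R * R => f_concave F z.1 z.2)).
  have [_] := @Ck_f_concave _ k.+1 _ _ _ open_state_space (Cfst _) (Csnd _) S1 S2.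
  exact.
by apply/funext => -[n T]; exact: derive1_fst.
Qed.

Lemma Ck_f_bulk k : Ck k state_space (fun z => f_bulk F z.1 z.2).
Proof.
apply: Ck_D; first exact: open_state_space.
  exact: (@Ck_f_convex _ k _ _ _ open_state_space (Cfst _) (Csnd _) S1 S2).
exact: (@Ck_f_concave _ k _ _ _ open_state_space (Cfst _) (Csnd _) S1 S2).
Qed.

Lemma Ck_f_bulk_T k : Ck k state_space (fun z => derive1 (fun t => f_bulk F z.1 t) z.2).
Proof.
rewrite (_ : (fun z => _) = 'D_(0, 1) (fun z : R * R => f_bulk F z.1 z.2)).
  by have [_] := Ck_f_bulk k.+1; exact.
by apply/funext => -[n T]; exact: (derive1_snd (f_bulk F)).
Qed.

Lemma Ck_c_inf_T k : Ck k state_space (fun z => derive1 (c_inf F) z.2).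
Proof.
rewrite (_ : (fun z => _) = 'D_(0, 1) (fun z : R * R => c_inf F z.2)).
  by have [_] := @Ck_c_inf _ k.+1 _ _ open_state_space (Csnd _) S2; exact.
by apply/funext => -[n T]; exact: (derive1_snd (fun _ => c_inf F)).
Qed.

Section fields.
Context {d : nat}.
Implicit Types (U : set 'rV[R]_d) (n T : 'rV[R]_d -> R) (k : nat).

Lemma Ck_partial k U f (i : 'I_d) : Ck k.+1 U f -> Ck k U (partial i f).
Proof. by move=> [_]; apply. Qed.

Lemma Ck_grad k U f (i : 'I_d) : Ck k.+1 U f -> Ck k U (fun x => grad f x ord0 i).
Proof.
move=> /Ck_partial Cf; rewrite (_ : (fun x => _) = partial i f); first exact: Cf.
by apply/funext => x; rewrite mxE.
Qed.

Lemma Ck_sqn k U (u : 'rV[R]_d -> 'rV[R]_d) : open U ->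
  (forall i, Ck k U (fun x => u x ord0 i)) -> Ck k U (fun x => sqn (u x)).
Proof. by move=> oU Cu; apply: (Ck_sum oU) => i; exact: Ck_M. Qed.

Lemma Ck_div k U (u : 'rV[R]_d -> 'rV[R]_d) : open U ->
  (forall i, Ck k.+1 U (fun x => u x ord0 i)) -> Ck k U (div u).
Proof. by move=> oU Cu; apply: (Ck_sum oU) => i; exact: Ck_partial. Qed.

Variables (U : set 'rV[R]_d) (n T : 'rV[R]_d -> R) (k : nat).
Hypotheses (oU : open U) (Cn : Ck k.+1 U n) (CT : Ck k.+1 U T)
  (nU : forall x, U x -> 0 < n x < (b_pr F)^-1) (TU : forall x, U x -> 0 < T x).

Let SU x : U x -> state_space (n x, T x).
Proof. by move=> Ux; split; [exact: nU|exact: TU]. Qed.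

Let Csg : Ck k U (fun x => sqn (grad n x)).
Proof. by apply: Ck_sqn => // i; exact: Ck_grad. Qed.

Lemma Ck_gamma_at : Ck k U (gamma_at F n T).
Proof.
apply: (Ck_D oU).
  exact: (Ck_comp2 oU SU (Ck_f_bulk_T k) (Ck_S Cn) (Ck_S CT)).
apply: (Ck_M oU); last exact: Ck_cst.
apply: (Ck_M oU) => //.
exact: (Ck_comp2 oU SU (Ck_c_inf_T k) (Ck_S Cn) (Ck_S CT)).
Qed.

Lemma Ck_entropy_at : Ck k U (entropy_at F n T).
Proof. by apply: (Ck_N oU); exact: Ck_gamma_at. Qed.

Lemma Ck_internal_energy_at : Ck k U (internal_energy_at F n T).
Proof.
apply: (Ck_D oU); last by apply: (Ck_M oU); [exact: Ck_S|exact: Ck_entropy_at].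
apply: (Ck_D oU); first exact: (Ck_comp2 oU SU (Ck_f_bulk k) (Ck_S Cn) (Ck_S CT)).
apply: (Ck_M oU); last exact: Ck_cst.
by apply: (Ck_M oU) => //; apply: Ck_c_inf => //; exact: Ck_S.
Qed.

End fields.

(** Two orders are lost to the divergence of c grad n; with data of class C^4 the potential is C^2
    and its gradient C^1, as the flux requires. *)
Lemma Ck_mu_next d k (U : set 'rV[R]_d) (nk nl nl1 Tl : 'rV[R]_d -> R) : open U ->
  Ck k.+2 U nk -> Ck k.+2 U nl -> Ck k.+2 U nl1 -> Ck k.+2 U Tl ->
  (forall x, U x -> 0 < nk x < (b_pr F)^-1) ->
  (forall x, U x -> 0 < nl x < (b_pr F)^-1) -> (forall x, U x -> 0 < Tl x) ->
  Ck k U (mu_next F nk nl nl1 Tl).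
Proof.
move=> oU Cnk Cnl Cnl1 CTl nkU nlU TU.
have le2 f : Ck k.+2 U f -> Ck k U f by move=> /Ck_S/Ck_S.
have Sk x : U x -> state_space (nk x, Tl x) by move=> Ux; split; [exact: nkU|exact: TU].
have Sl x : U x -> state_space (nl x, Tl x) by move=> Ux; split; [exact: nlU|exact: TU].
apply: (Ck_B oU).
  apply: (Ck_D oU); last exact: (Ck_comp2 oU Sk (Ck_mu_concave k) (le2 _ Cnk) (le2 _ CTl)).
  apply: (Ck_D oU); first exact: (Ck_comp2 oU Sl (Ck_mu_convex k) (le2 _ Cnl) (le2 _ CTl)).
  apply: (Ck_M oU); first exact: (Ck_comp2 oU Sl (Ck_mu_convex_n k) (le2 _ Cnl) (le2 _ CTl)).
  by apply: (Ck_B oU); exact: le2.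
apply: Ck_div => // i.
have Cc : Ck k.+1 U (fun y => c_inf F (Tl y)) by apply: Ck_c_inf => //; exact: Ck_S.
apply: (Ck_eq oU _ (Ck_M oU Cc (Ck_grad i Cnl1))).
by move=> x _; rewrite !mxE.
Qed.

End fluid.

(** * Differentiation rules, common neighbourhoods and integrability *)

Section partial_rules.
Context {R : realType} {d : nat}.
Variables (W : set 'rV[R]_d) (x : 'rV[R]_d).
Hypotheses (oW : open W) (Wx : W x).
Implicit Types (f g : 'rV[R]_d -> R) (i : 'I_d).

Lemma partialD i f g : Ck 1 W f -> Ck 1 W g ->
  partial i (fun y => f y + g y) x = partial i f x + partial i g x.
Proof.
by move=> Cf Cg; apply: deriveD; [exact: Ck_derivable Cf Wx|exact: Ck_derivable Cg Wx].
Qed.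

Lemma partialB i f g : Ck 1 W f -> Ck 1 W g ->
  partial i (fun y => f y - g y) x = partial i f x - partial i g x.
Proof.
by move=> Cf Cg; apply: deriveB; [exact: Ck_derivable Cf Wx|exact: Ck_derivable Cg Wx].
Qed.

Lemma partialM i f g : Ck 1 W f -> Ck 1 W g ->
  partial i (fun y => f y * g y) x = partial i f x * g x + f x * partial i g x.
Proof.
move=> Cf Cg; rewrite /partial deriveM; [|exact: Ck_derivable Cf Wx|exact: Ck_derivable Cg Wx].
by rewrite /GRing.scale/= addrC mulrC.
Qed.

Lemma partialZ i a f : Ck 1 W f ->
  partial i (fun y => a * f y) x = a * partial i f x.
Proof.
move=> Cf; rewrite (@partialM i (cst a) f)//; last exact: Ck_cst.
by rewrite /partial derive_cst mul0r add0r.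
Qed.

Lemma partial_sum i m (f : 'I_m -> 'rV[R]_d -> R) : (forall j, Ck 1 W (f j)) ->
  partial i (fun y => \sum_j f j y) x = \sum_j partial i (f j) x.
Proof.
elim: m f => [|m IH] f Cf.
  rewrite big_ord0 (_ : (fun _ => _) = cst 0) ?/partial ?derive_cst//.
  by apply/funext => y; rewrite big_ord0.
rewrite big_ord_recl -IH// -partialD//.
  by congr partial; apply/funext => y; rewrite big_ord_recl.
exact: Ck_sum.
Qed.

Lemma eq_partial i (A : set 'rV[R]_d) f g : open A -> A x ->
  (forall y, A y -> f y = g y) -> partial i f x = partial i g x.
Proof. by move=> oA Ax fg; exact: (@eq_derive_on _ _ A). Qed.

(** Serves to shrink a neighbourhood of the closure until densities and temperatures stay in the
    state space on it. *)
Lemma open_pos f : Ck 0 W f -> open (W `&` [set y | 0 < f y]).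
Proof.
move=> Cf; rewrite openE => y [Wy fy].
apply: filterI; first exact: (nearU oW Wy).
by have := Cf y Wy; move=> /cvgr_gt; apply.
Qed.

End partial_rules.

Section smooth.
Context {R : realType} {d : nat} (Omega : set 'rV[R]_d).

Lemma smooth_upto_family k m (f : 'I_m -> 'rV[R]_d -> R) :
  (forall i, smooth_upto k Omega (f i)) ->
  exists U, [/\ open U, closure Omega `<=` U & forall i, Ck k U (f i)].
Proof.
elim: m f => [|m IH] f Hf; first by exists setT; split => //; [exact: openT|case].
have [U [oU OU CU]] := IH (fun i => f (lift ord0 i)) (fun i => Hf _).
have [V [oV OV CV]] := Hf ord0.
exists (U `&` V); split; [exact: openI|by move=> x cx; split; [exact: OU|exact: OV]|].
move=> i; have [j ->|->] := unliftP ord0 i.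
  by apply: Ck_sub (CU j) => x [].
by apply: Ck_sub CV => x [].
Qed.

End smooth.

Section integrability.
Context {R : realType} {n : nat} (Omega : set 'rV[R]_n.+1).
Hypothesis dOmega : @bounded_C1_domain R n.+1 Omega.

Lemma integrable_domain U f : open U -> closure Omega `<=` U -> Ck 0 U f ->
  (lebesgue_rV n.+1).-integrable Omega (EFin \o f).
Proof.
move=> oU OU Cf.
have cO := compact_closure_domain dOmega.
have oO : open Omega by case: dOmega.
have SO : Omega `<=` closure Omega by exact: subset_closure.
have [K [_ HK]] : bounded_set (f @` closure Omega).
  apply: compact_bounded; apply: continuous_compact => //.
  by apply: continuous_in_subspaceT => x /set_mem /OU; exact: Cf.
have [M [_ HM]] := compact_bounded cO.
apply: measurable_bounded_integrable.
- exact: open_measurable_rV.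
- apply: (@le_lt_trans _ _ (lebesgue_rV n.+1 (cube (M + 1)))); last exact: cube_lty.
  apply: le_measure; rewrite ?inE; [exact: open_measurable_rV|exact: measurable_cube|].
  move=> x /SO /(HM (M + 1)) -/(_ _) h i.
  have : `|x| <= M + 1 by apply: h; rewrite ltrDl.
  apply: le_trans; rewrite /Num.Def.normr/= mx_normrE.
  by apply: (le_bigmax _ (fun ij => `|x ij.1 ij.2|) (ord0, i)).
- by apply: continuous_measurable_rV => // x /SO/OU; exact: Cf.
- exists K; split; first exact: num_real.
  by move=> y Ky x /SO cx; apply: (HK y Ky); exists x.
Qed.

End integrability.

(** Rests on |u1|^2 - |uk|^2 = 2 u1 . (u1 - us) - |u1 - us|^2 + 2 us . (us - uk) - |us - uk|^2. The
    definition of [us] gives rho (us - uk) = - dt G, and subtracting it from the momentum equation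
    gives rho (u1 - us) = dt (visc - rho A). *)
Lemma kinetic_identity (R : realFieldType) d (rho dt : R) (u1 uk us G A visc : 'I_d -> R) :
  rho != 0 -> dt != 0 ->
  (forall j, us j = uk j - dt / rho * G j) ->
  (forall j, rho * (dt^-1 * (u1 j - uk j) + A j) = - G j + visc j) ->
  rho * (\sum_j u1 j * u1 j - \sum_j uk j * uk j) / (2 * dt) =
  - (rho * \sum_j u1 j * A j) + \sum_j u1 j * visc j - \sum_j us j * G j
  - (2 * dt)^-1 * rho * (\sum_j (u1 j - us j) * (u1 j - us j) +
      \sum_j (us j - uk j) * (us j - uk j)).
Proof.
move=> rho0 dt0 Eus Emom.
have EG j : G j = (uk j - us j) * rho / dt by rewrite Eus; field; rewrite rho0 dt0.
have Ev j : visc j = rho * (dt^-1 * (u1 j - uk j) + A j) + (uk j - us j) * rho / dt.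
  by rewrite Emom EG; ring.
rewrite -sumrB -big_split/= !mulr_sumr -sumrN -big_split/= -!sumrB mulr_suml.
apply: eq_bigr => j _; rewrite EG Ev.
by field.
Qed.

(** Scalar bookkeeping: X is the internal energy quotient, N the divergence of n us, q1 and qk the
    squared speeds, w the sum of the two squared increments, se1 to se7 the divergences of the seven
    terms of the flux. The energy equation gains in w what the kinetic identity loses. *)
Lemma energy_identity (R : realFieldType) (X N M q1 qk n dt w se1 se2 se3 se4 se5 se6 se7
    d5 d6 d7 uA uv uG sT s mu vd ld : R) : dt != 0 ->
  X + d5 = d6 - d7 - mu * N - - s * sT + vd + ld + (2 * dt)^-1 * (n * M) * w ->
  n * M * (q1 - qk) / (2 * dt) =
    - (n * M * uA) + uv - uG - (2 * dt)^-1 * (n * M) * w ->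
  se1 = N * q1 + 2 * n * uA -> se2 + se3 = uv + vd + ld ->
  se4 + s * sT = mu * N + uG -> se5 = d5 -> se6 = d6 -> d7 = - se7 ->
  X - N * M * q1 / 2 + n * M * (q1 - qk) / (2 * dt) =
    - (M / 2) * se1 + se2 + se3 - se4 - se5 + se6 + se7.
Proof.
move=> dt0 /(canRL (addrK _)) -> -> -> /(canRL (addKr _)) -> /(canRL (addrK _)) -> -> -> ->.
by field.
Qed.

(** * The flux and the local balance law *)

Section energy_flux.
Context {R : realType} {d : nat}.
Variables (Omega W : set 'rV[R]_d) (dt M : R).
Variables (nk nl1 mu s gam Tl Tl1 eta lam Th c th1 thk : 'rV[R]_d -> R).
Variables (uk us u1 : 'rV[R]_d -> 'rV[R]_d).
Hypotheses (oO : open Omega) (oW : open W) (OW : Omega `<=` W).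
Hypotheses (dt0 : dt != 0) (M0 : M != 0) (nk0 : forall x, W x -> nk x != 0).
Hypotheses (Cmu : Ck 2 W mu) (Cnk : Ck 1 W nk) (Cnl1 : Ck 2 W nl1) (CTl : Ck 2 W Tl)
  (CTl1 : Ck 2 W Tl1) (Cs : Ck 1 W s) (Ceta : Ck 1 W eta) (Clam : Ck 1 W lam)
  (CTh : Ck 1 W Th) (Cc : Ck 1 W c).
Hypotheses (Cuk : forall i, Ck 1 W (fun x => uk x ord0 i))
  (Cu1 : forall i, Ck 2 W (fun x => u1 x ord0 i)).

(* [us] is only known inside [Omega]; [ustar] is the C^1 field given by its defining
   formula near the closure. *)
Definition ustar i x := uk x ord0 i -
  dt / (nk x * M) * (nk x * partial i mu x + s x * partial i Tl x).

Hypothesis sgam : forall x, gam x = - s x.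
Hypothesis Eus : forall x, Omega x -> forall i, us x ord0 i = ustar i x.
Hypothesis Emass : forall x, Omega x ->
  (nl1 x - nk x) / dt + div (fun y => nk y *: us y) x = 0.
Hypothesis Emom : forall x, Omega x ->
  (nk x * M) *: (dt^-1 *: (u1 x - uk x) + convect us u1 x) =
    - (nk x *: grad mu x) + gam x *: grad Tl x
    + div_tensor (fun y => eta y *: Dsym u1 y) x
    + grad (fun y => lam y * div u1 y) x.
Hypothesis Eenergy : forall x, Omega x ->
  (th1 x - thk x) / dt + div (fun y => (s y * Tl y) *: us y) x =
    div (fun y => Th y *: grad Tl1 y) x
    - div (fun y => (div (fun y => nk y *: us y) y * c y) *: grad nl1 y) x
    - mu x * div (fun y => nk y *: us y) x
    - dot (us x) (gam x *: grad Tl x)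
    + eta x * ddot (Dsym u1 x) (grad_vec u1 x)
    + lam x * div u1 x ^+ 2
    + (2%:R * dt)^-1 * (nk x * M) * (sqn (u1 x - us x) + sqn (us x - uk x)).

Let C2 f : Ck 2 W f -> Ck 1 W f. Proof. exact: Ck_S. Qed.

Let Cp i f : Ck 2 W f -> Ck 1 W (partial i f). Proof. exact: Ck_partial. Qed.

Lemma Ck_ustar i : Ck 1 W (ustar i).
Proof.
have Cr : Ck 1 W (fun x => nk x * M) := Ck_M oW Cnk (Ck_cst 1 W M).
have Crv : Ck 1 W (fun x => (nk x * M)^-1).
  by apply: (Ck_V oW _ Cr) => x Wx; rewrite mulf_neq0// nk0.
exact: (Ck_B oW (Cuk i) (Ck_M oW (Ck_M oW (Ck_cst 1 W dt) Crv)
  (Ck_D oW (Ck_M oW Cnk (Cp i Cmu)) (Ck_M oW Cs (Cp i CTl))))).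
Qed.

Let m i x := nk x * ustar i x.
Let Cm i : Ck 1 W (m i). Proof. exact: (Ck_M oW Cnk (Ck_ustar i)). Qed.
Let Cdiv : Ck 1 W (div u1). Proof. exact: (Ck_div oW Cu1). Qed.
Let CD i j : Ck 1 W (fun x => Dsym u1 x i j).
Proof.
apply: (Ck_eq oW _ (Ck_D oW (Cp j (Cu1 i)) (Cp i (Cu1 j)))) => x _.
by rewrite !mxE.
Qed.
Let Cu i : Ck 1 W (fun x => u1 x ord0 i). Proof. exact: (C2 (Cu1 i)). Qed.
Let Csq : Ck 1 W (fun x => sqn (u1 x)). Proof. exact: (Ck_sqn oW Cu). Qed.

Let e1 i x := m i x * sqn (u1 x).
Let e2 i x := \sum_j eta x * Dsym u1 x j i * u1 x ord0 j.
Let e3 i x := lam x * div u1 x * u1 x ord0 i.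
Let e4 i x := mu x * m i x.
Let e5 i x := s x * Tl x * ustar i x.
Let e6 i x := Th x * partial i Tl1 x.
Let e7 i x := (nl1 x - nk x) / dt * c x * partial i nl1 x.

Let C_e1 i : Ck 1 W (e1 i). Proof. exact: (Ck_M oW (Cm i) Csq). Qed.
Let C_e2j i j : Ck 1 W (fun x => eta x * Dsym u1 x j i * u1 x ord0 j).
Proof. exact: (Ck_M oW (Ck_M oW Ceta (CD j i)) (Cu j)). Qed.
Let C_e2 i : Ck 1 W (e2 i). Proof. exact: (Ck_sum oW (C_e2j i)). Qed.
Let C_e3 i : Ck 1 W (e3 i). Proof. exact: (Ck_M oW (Ck_M oW Clam Cdiv) (Cu i)). Qed.
Let C_e4 i : Ck 1 W (e4 i). Proof. exact: (Ck_M oW (C2 Cmu) (Cm i)). Qed.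
Let C_e5 i : Ck 1 W (e5 i).
Proof. exact: (Ck_M oW (Ck_M oW Cs (C2 CTl)) (Ck_ustar i)). Qed.
Let C_e6 i : Ck 1 W (e6 i). Proof. exact: (Ck_M oW CTh (Cp i CTl1)). Qed.
Let C_e7 i : Ck 1 W (e7 i).
Proof.
exact: (Ck_M oW (Ck_M oW (Ck_M oW (Ck_B oW (C2 Cnl1) Cnk) (Ck_cst 1 W dt^-1)) Cc) (Cp i Cnl1)).
Qed.

Definition energy_flux i x :=
  - (M / 2) * (nk x * ustar i x * sqn (u1 x))
  + \sum_j eta x * Dsym u1 x j i * u1 x ord0 j
  + lam x * div u1 x * u1 x ord0 i
  - mu x * (nk x * ustar i x)
  - s x * Tl x * ustar i x
  + Th x * partial i Tl1 x
  + (nl1 x - nk x) / dt * c x * partial i nl1 x.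

Lemma Ck_energy_flux i : Ck 1 W (energy_flux i).
Proof.
exact: (Ck_D oW (Ck_D oW (Ck_B oW (Ck_B oW (Ck_D oW (Ck_D oW
  (Ck_M oW (Ck_cst 1 W (- (M / 2))) (C_e1 i)) (C_e2 i)) (C_e3 i)) (C_e4 i)) (C_e5 i))
  (C_e6 i)) (C_e7 i)).
Qed.

Lemma partial_energy_flux i x : W x -> partial i (energy_flux i) x =
  - (M / 2) * partial i (e1 i) x + partial i (e2 i) x + partial i (e3 i) x
  - partial i (e4 i) x - partial i (e5 i) x + partial i (e6 i) x + partial i (e7 i) x.
Proof.
move=> Wx.
have C1 : Ck 1 W (fun x => - (M / 2) * e1 i x) := Ck_M oW (Ck_cst 1 W _) (C_e1 i).
have C12 := Ck_D oW C1 (C_e2 i).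
have C13 := Ck_D oW C12 (C_e3 i).
have C14 := Ck_B oW C13 (C_e4 i).
have C15 := Ck_B oW C14 (C_e5 i).
have C16 := Ck_D oW C15 (C_e6 i).
rewrite -(partialZ Wx i (- (M / 2)) (C_e1 i)).
rewrite -(partialD Wx i C1 (C_e2 i)) -(partialD Wx i C12 (C_e3 i)).
rewrite -(partialB Wx i C13 (C_e4 i)) -(partialB Wx i C14 (C_e5 i)).
by rewrite -(partialD Wx i C15 (C_e6 i)) -(partialD Wx i C16 (C_e7 i)).
Qed.

Lemma energy_balance x : Omega x ->
  (th1 x + nl1 x * M * sqn (u1 x) / 2 - thk x - nk x * M * sqn (uk x) / 2) / dt =
  \sum_i partial i (energy_flux i) x.
Proof.
move=> Ox; have Wx := OW Ox.
under eq_bigr do rewrite partial_energy_flux//.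
rewrite !big_split/= !sumrN -mulr_sumr.
have Ediv y : Omega y -> div (fun y => nk y *: us y) y = - ((nl1 y - nk y) / dt).
  by move=> /Emass /eqP; rewrite addrC addr_eq0 => /eqP.
pose N := \sum_i partial i (m i) x.
(* [us] may be replaced by [ustar] under derivatives, since the two agree on the open set Omega. *)
have EN : div (fun y => nk y *: us y) x = N.
  apply: eq_bigr => i _; apply: (eq_partial _ oO Ox) => y Oy.
  by rewrite mxE Eus.
have E5 : \sum_i partial i (e5 i) x = div (fun y => (s y * Tl y) *: us y) x.
  apply: eq_bigr => i _; apply: (eq_partial _ oO Ox) => y Oy.
  by rewrite mxE Eus.
have E6 : \sum_i partial i (e6 i) x = div (fun y => Th y *: grad Tl1 y) x.
  apply: eq_bigr => i _; apply: (eq_partial _ oO Ox) => y _.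
  by rewrite !mxE.
have E7 : div (fun y => (div (fun y => nk y *: us y) y * c y) *: grad nl1 y) x =
   - \sum_i partial i (e7 i) x.
  rewrite -mulN1r mulr_sumr; apply: eq_bigr => i _.
  rewrite -(partialZ Wx i (-1) (C_e7 i)).
  apply: (eq_partial _ oO Ox) => y Oy.
  by rewrite !mxE Ediv// /e7; ring.
pose A j := convect us u1 x ord0 j.
have EA j : A j = \sum_i ustar i x * partial i (fun y => u1 y ord0 j) x.
  by rewrite /A mxE; apply: eq_bigr => i _; rewrite Eus.
have Esq i : partial i (fun y => sqn (u1 y)) x =
    \sum_j 2 * (u1 x ord0 j * partial i (fun y => u1 y ord0 j) x).
  rewrite (partial_sum oW Wx i (fun j => Ck_M oW (Cu j) (Cu j))).
  by apply: eq_bigr => j _; rewrite (partialM Wx i (Cu j) (Cu j)); ring.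
have E1 : \sum_i partial i (e1 i) x = N * sqn (u1 x) + 2 * nk x * \sum_j u1 x ord0 j * A j.
  under eq_bigr => i _ do rewrite (partialM Wx i (Cm i) Csq) Esq.
  rewrite big_split/= -mulr_suml; congr (_ + _).
  transitivity (\sum_i \sum_j 2 * nk x * (u1 x ord0 j * (ustar i x * partial i (fun y => u1 y ord0 j) x))).
    by apply: eq_bigr => i _; rewrite mulr_sumr; apply: eq_bigr => j _; rewrite /m; ring.
  rewrite exchange_big mulr_sumr; apply: eq_bigr => j _.
  by rewrite EA !mulr_sumr.
pose visc j := \sum_i partial i (fun y => eta y * Dsym u1 y j i) x +
  partial j (fun y => lam y * div u1 y) x.
(* The divergence of stress times velocity is the work of the viscous force plus viscous heating. *)
have E23 : \sum_i partial i (e2 i) x + \sum_i partial i (e3 i) x =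
   \sum_j u1 x ord0 j * visc j + eta x * ddot (Dsym u1 x) (grad_vec u1 x) + lam x * div u1 x ^+ 2.
  have E2 : \sum_i partial i (e2 i) x =
     \sum_j u1 x ord0 j * \sum_i partial i (fun y => eta y * Dsym u1 y j i) x +
     eta x * ddot (Dsym u1 x) (grad_vec u1 x).
    rewrite /ddot mulr_sumr -big_split/=.
    under eq_bigr => i _.
      rewrite (partial_sum oW Wx i (C_e2j i)).
      under eq_bigr => j _ do rewrite (partialM Wx i (Ck_M oW Ceta (CD j i)) (Cu j)).
      over.
    rewrite exchange_big/=; apply: eq_bigr => j _.
    rewrite big_split/= -mulr_suml mulrC; congr (_ + _).
    rewrite mulr_sumr; apply: eq_bigr => i _.
    by rewrite [grad_vec _ _ _ _]mxE mulrA.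
  have E3 : \sum_i partial i (e3 i) x =
     \sum_j u1 x ord0 j * partial j (fun y => lam y * div u1 y) x + lam x * div u1 x ^+ 2.
    under eq_bigr => i _ do rewrite (partialM Wx i (Ck_M oW Clam Cdiv) (Cu i)) mulrC.
    by rewrite big_split/= -mulr_sumr expr2 mulrA.
  rewrite E2 E3; under [in RHS]eq_bigr do rewrite mulrDr.
  by rewrite big_split/=; ring.
(* The force in the definition of [us]; the same one enters the momentum equation because gamma is
   minus the entropy. *)
pose G j := nk x * partial j mu x + s x * partial j Tl x.
have E4 : \sum_i partial i (e4 i) x + s x * \sum_i ustar i x * partial i Tl x =
    mu x * N + \sum_j ustar j x * G j.
  under eq_bigr => i _ do rewrite (partialM Wx i (C2 Cmu) (Cm i)).
  rewrite big_split/= -mulr_sumr -/N [LHS]addrAC [LHS]addrC; congr (_ + _).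
  rewrite mulr_sumr -big_split/=; apply: eq_bigr => i _.
  by rewrite /G /m; ring.
have Edot : dot (us x) (gam x *: grad Tl x) = - s x * \sum_i ustar i x * partial i Tl x.
  rewrite mulr_sumr; apply: eq_bigr => i _.
  by rewrite !mxE Eus// sgam; ring.
have r0 : nk x * M != 0 by rewrite mulf_neq0// nk0.
have Edt j : div_tensor (fun y => eta y *: Dsym u1 y) x ord0 j =
    \sum_i partial i (fun y => eta y * Dsym u1 y j i) x.
  rewrite mxE; apply: eq_bigr => i _; congr partial; apply/funext => y.
  by rewrite !mxE.
have Hus j : us x ord0 j = uk x ord0 j - dt / (nk x * M) * G j by rewrite Eus.
have Hmom j : nk x * M * (dt^-1 * (u1 x ord0 j - uk x ord0 j) + A j) = - G j + visc j.
  have := congr1 (fun v : 'rV[R]_d => v ord0 j) (Emom Ox).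
  (* Abstracting the two vectors keeps [mxE] from unfolding them. *)
  rewrite /A; move: (convect us u1 x) (div_tensor _ x) Edt => a b Edt.
  rewrite !mxE Edt sgam => ->; rewrite /G /visc; ring.
have K := kinetic_identity r0 dt0 Hus Hmom.
have sqB (a b : 'rV[R]_d) : sqn (a - b) = \sum_j (a ord0 j - b ord0 j) * (a ord0 j - b ord0 j).
  by apply: eq_bigr => j _; rewrite !mxE.
rewrite -!sqB -!/(sqn _) in K.
have EE := Eenergy Ox.
rewrite EN Edot in EE.
have EusG : \sum_j us x ord0 j * G j = \sum_j ustar j x * G j.
  by apply: eq_bigr => j _; rewrite Eus.
rewrite EusG in K.
(* The density increment is paired with the new velocity and the velocity increment with the old
   density; the mass equation turns the former into N. *)
have EX : (th1 x + nl1 x * M * sqn (u1 x) / 2 - thk x - nk x * M * sqn (uk x) / 2) / dt =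
   (th1 x - thk x) / dt - N * M * sqn (u1 x) / 2 + nk x * M * (sqn (u1 x) - sqn (uk x)) / (2 * dt).
  by rewrite -EN Ediv//; field.
by rewrite EX; exact: (energy_identity dt0 EE K E1 E23 E4 E5 E6 E7).
Qed.

End energy_flux.

(** * Integration of the balance law and the boundary terms *)

Section Rintegral_sums.
Context {d} {T : measurableType d} {R : realType} (mu : {measure set T -> \bar R}).
Variables (D : set T) (mD : measurable D).

Lemma Rintegrable_scale (a : R) (f : T -> R) : mu.-integrable D (EFin \o f) ->
  mu.-integrable D (EFin \o (fun x => a * f x)).
Proof.
by move=> /(integrableZl mD a); apply: eq_integrable => // x _.
Qed.

Lemma Rintegral_sum m (f : 'I_m -> T -> R) :
  (forall i, mu.-integrable D (EFin \o f i)) ->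
  mu.-integrable D (EFin \o (fun x => \sum_i f i x)) /\
  \int[mu]_(x in D) (\sum_i f i x) = \sum_i \int[mu]_(x in D) f i x.
Proof.
elim: m f => [|m IH] f fi.
  have -> : (fun x => \sum_i f i x) = cst 0 by apply/funext => x; rewrite big_ord0.
  by rewrite big_ord0 Rintegral_cst// mul0r; split => //; exact: integrable0.
have -> : (fun x => \sum_i f i x) = (fun x => f ord0 x + \sum_i f (lift ord0 i) x).
  by apply/funext => x; rewrite big_ord_recl.
have [i1 e1] := IH (fun i => f (lift ord0 i)) (fun i => fi _).
split; first exact: (integrableD mD (fi ord0) i1).
by rewrite big_ord_recl (RintegralD mD (fi ord0) i1) e1.
Qed.

End Rintegral_sums.

Theorem theorem4p3 (R : realType) (d : nat) (F : pr_fluid R)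
    (eta xi Theta : R * R -> R)
    (Omega : set 'rV[R]_d) (nu : 'rV[R]_d -> 'rV[R]_d)
    (sigma : {measure set 'rV[R]_d -> \bar R}) (dt : R)
    (nk nl nl1 Tk Tl Tl1 : 'rV[R]_d -> R)
    (uk us ul1 : 'rV[R]_d -> 'rV[R]_d) :
  let state_space : set (R * R) :=
    [set p | 0 < p.1 < (b_pr F)^-1 /\ 0 < p.2] in
  let lambda p := xi p - 2%:R / 3%:R * eta p in
  let eta_k x := eta (nk x, Tk x) in
  let lambda_k x := lambda (nk x, Tk x) in
  let Theta_k x := Theta (nk x, Tk x) in
  let rho_k := mass_density F nk in
  let rho_l1 := mass_density F nl1 in
  let gamma_k := gamma_at F nk Tk in
  let s_k := entropy_at F nk Tk in
  let theta_k := internal_energy_at F nk Tk in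
  let theta_l1 := internal_energy_next F nl1 Tl Tl1 in
  let mu_l1 := mu_next F nk nl nl1 Tl in
  let nus x := nk x *: us x in
  let q x := - (Theta_k x *: grad Tl1 x) in
  (* dimension, fluid, domain, time step *)
  (0 < d)%N ->
  0 < Rgas F -> 0 < Tcrit F -> 0 < Pcrit F -> 0 < Mweight F ->
  bounded_C1_domain Omega ->
  outward_unit_normal Omega nu ->
  surface_measure Omega sigma ->
  0 < dt ->
  (* transport coefficients *)
  (forall p, state_space p ->
     [/\ 0 < eta p, 2%:R / 3%:R * eta p < xi p & 0 <= Theta p]) ->
  Ck 1 state_space eta -> Ck 1 state_space xi -> Ck 1 state_space Theta ->
  (* regularity and admissibility *)
  [/\ smooth_upto 4 Omega nk, smooth_upto 4 Omega nl & smooth_upto 4 Omega nl1] ->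
  [/\ smooth_upto 4 Omega Tk, smooth_upto 4 Omega Tl & smooth_upto 4 Omega Tl1] ->
  (forall i, smooth_upto 2 Omega (fun x => uk x ord0 i) /\
             smooth_upto 2 Omega (fun x => ul1 x ord0 i)) ->
  (forall x, closure Omega x ->
     [/\ 0 < nk x < (b_pr F)^-1, 0 < nl x < (b_pr F)^-1 &
         0 < nl1 x < (b_pr F)^-1]) ->
  (forall x, closure Omega x -> [/\ 0 < Tk x, 0 < Tl x & 0 < Tl1 x]) ->
  (* the scheme *)
  (forall x, Omega x ->
     us x = uk x - (dt / rho_k x) *:
                     (nk x *: grad mu_l1 x + s_k x *: grad Tl x)) ->
  (forall x, Omega x ->
     (nl1 x - nk x) / dt + div nus x = 0) ->
  (forall x, Omega x ->
     rho_k x *: (dt^-1 *: (ul1 x - uk x) + convect us ul1 x) =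
       - (nk x *: grad mu_l1 x) + gamma_k x *: grad Tl x
       + div_tensor (fun y => eta_k y *: Dsym ul1 y) x
       + grad (fun y => lambda_k y * div ul1 y) x) ->
  (forall x, Omega x ->
     (theta_l1 x - theta_k x) / dt
       + div (fun y => (s_k y * Tl y) *: us y) x =
     div (fun y => Theta_k y *: grad Tl1 y) x
       - div (fun y => (div nus y * c_inf F (Tl y)) *: grad nl1 y) x
       - mu_l1 x * div nus x
       - dot (us x) (gamma_k x *: grad Tl x)
       + eta_k x * ddot (Dsym ul1 x) (grad_vec ul1 x)
       + lambda_k x * div ul1 x ^+ 2
       + (2%:R * dt)^-1 * rho_k x
         * (sqn (ul1 x - us x) + sqn (us x - uk x))) ->
  (* boundary conditions *)
  (forall x, boundary Omega x -> [/\ uk x = 0, ul1 x = 0 & us x = 0]) ->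
  (forall x, boundary Omega x ->
     [/\ dot (grad nk x) (nu x) = 0, dot (grad nl x) (nu x) = 0 &
         dot (grad nl1 x) (nu x) = 0]) ->
  (* no normal component of the gradient terms entering us at the boundary *)
  (forall x, boundary Omega x ->
     dot (nk x *: grad mu_l1 x + s_k x *: grad Tl x) (nu x) = 0) ->
  (total_energy Omega rho_l1 ul1 theta_l1 - total_energy Omega rho_k uk theta_k)
    / dt
  = - \int[sigma]_(x in boundary Omega) dot (q x) (nu x).
Proof.
case: d Omega nu sigma nk nl nl1 Tk Tl Tl1 uk us ul1 => [//|n] Omega nu sigma
  nk nl nl1 Tk Tl Tl1 uk us ul1 S lambda eta_k lambda_k Theta_k rho_k rho_l1 gamma_k
  s_k theta_k theta_l1 mu_l1 nus q _ R0 Tc0 Pc0 M0 dO onu ssig dt0 _ Ceta Cxi CTheta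
  [[U1 [oU1 OU1 C1]] [U2 [oU2 OU2 C2]] [U3 [oU3 OU3 C3]]]
  [[U4 [oU4 OU4 C4]] [U5 [oU5 OU5 C5]] [U6 [oU6 OU6 C6]]] Hu npos Tpos
  Eus Emass Emom Eenergy bu bn bmu.
have [U7 [oU7 OU7 C7]] := smooth_upto_family (fun i => (Hu i).1).
have [U8 [oU8 OU8 C8]] := smooth_upto_family (fun i => (Hu i).2).
(* A common neighbourhood of the closure for all data, cut down below to the open set where [nk],
   [nl], [Tk] and [Tl] are admissible. *)
pose W0 := U1 `&` U2 `&` U3 `&` U4 `&` U5 `&` U6 `&` U7 `&` U8.
have oW0 : open W0 by do 7 (apply: openI => //).
have OW0 x : closure Omega x -> W0 x by move=> cx; do 7 (split; [|by auto]); auto.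
have bi0 : 0 < (b_pr F)^-1 by rewrite invr_gt0 b_pr_gt0.
have W01 : W0 `<=` U1 by move=> x; rewrite /W0 /=; tauto.
have W02 : W0 `<=` U2 by move=> x; rewrite /W0 /=; tauto.
have W03 : W0 `<=` U3 by move=> x; rewrite /W0 /=; tauto.
have W04 : W0 `<=` U4 by move=> x; rewrite /W0 /=; tauto.
have W05 : W0 `<=` U5 by move=> x; rewrite /W0 /=; tauto.
have W06 : W0 `<=` U6 by move=> x; rewrite /W0 /=; tauto.
have W07 : W0 `<=` U7 by move=> x; rewrite /W0 /=; tauto.
have W08 : W0 `<=` U8 by move=> x; rewrite /W0 /=; tauto.
have K0 k U f : W0 `<=` U -> Ck k U f -> Ck 0 W0 f.
  by move=> WU Cf; exact: (Ck_le (leq0n k) (Ck_sub WU Cf)).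
have p1 := open_pos oW0 (K0 _ _ _ W01 C1).
have p2 := open_pos oW0 (Ck_B oW0 (Ck_cst 0 W0 (b_pr F)^-1) (K0 _ _ _ W01 C1)).
have p3 := open_pos oW0 (K0 _ _ _ W02 C2).
have p4 := open_pos oW0 (Ck_B oW0 (Ck_cst 0 W0 (b_pr F)^-1) (K0 _ _ _ W02 C2)).
have p5 := open_pos oW0 (K0 _ _ _ W04 C4).
have p6 := open_pos oW0 (K0 _ _ _ W05 C5).
set A1 := (X in open X) in p1; set A2 := (X in open X) in p2.
set A3 := (X in open X) in p3; set A4 := (X in open X) in p4.
set A5 := (X in open X) in p5; set A6 := (X in open X) in p6.
pose W := A1 `&` A2 `&` A3 `&` A4 `&` A5 `&` A6.
have oW : open W by do 5 (apply: openI => //).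
have OW : closure Omega `<=` W.
  move=> x cx; have Wx := OW0 x cx.
  have [/andP[a1 a2] /andP[a3 a4] _] := npos x cx; have [t1 t2 _] := Tpos x cx.
  by do 5 (split; [|by split => //=; rewrite ?subr_gt0]); split => //=; rewrite ?subr_gt0.
have WW0 : W `<=` W0 by move=> x [_ []].
have nkW x : W x -> 0 < nk x < (b_pr F)^-1.
  rewrite /W => -[[[[[[_ /= h] [_ /= h2]] _] _] _] _]; rewrite subr_gt0 in h2; by apply/andP.
have nlW x : W x -> 0 < nl x < (b_pr F)^-1.
  rewrite /W => -[[[[_ [_ /= h]] [_ /= h2]] _] _]; rewrite subr_gt0 in h2; by apply/andP.
have TkW x : W x -> 0 < Tk x by move=> [[_ [_ h]] _]; exact: h.
have TlW x : W x -> 0 < Tl x by move=> [_ [_ h]]; exact: h.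
have CC k U f : W0 `<=` U -> Ck k U f -> Ck k W f.
  by move=> WU; apply: Ck_sub => x /WW0 /WU.
move/(CC _ _ _ W01): C1 => Cnk; move/(CC _ _ _ W02): C2 => Cnl.
move/(CC _ _ _ W03): C3 => Cnl1; move/(CC _ _ _ W04): C4 => CTk.
move/(CC _ _ _ W05): C5 => CTl; move/(CC _ _ _ W06): C6 => CTl1.
have Cuk i := CC _ _ _ W07 (C7 i). have Cu1 i := CC _ _ _ W08 (C8 i).
have SW x : W x -> state_space F (nk x, Tk x).
  by move=> Wx; split; [exact: nkW|exact: TkW].
have le1 f : Ck 4 W f -> Ck 1 W f by exact: Ck_le.
have le2 f : Ck 4 W f -> Ck 2 W f by exact: Ck_le.
have oO : open Omega by case: dO.
have OsubW : Omega `<=` W by move=> x Ox; apply: OW; exact: subset_closure.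
have Cmu : Ck 2 W mu_l1.
  exact: (Ck_mu_next R0 Tc0 Pc0 oW Cnk Cnl Cnl1 CTl nkW nlW TlW).
have Cs : Ck 1 W s_k := Ck_entropy_at R0 Tc0 Pc0 oW (le2 _ Cnk) (le2 _ CTk) nkW TkW.
have Ceta_k : Ck 1 W eta_k := Ck_comp2 oW SW Ceta (le1 _ Cnk) (le1 _ CTk).
have Cxi_k : Ck 1 W (fun x => xi (nk x, Tk x)) := Ck_comp2 oW SW Cxi (le1 _ Cnk) (le1 _ CTk).
have Clam_k : Ck 1 W lambda_k := Ck_B oW Cxi_k (Ck_M oW (Ck_cst 1 W (2%:R / 3%:R)) Ceta_k).
have CTh_k : Ck 1 W Theta_k := Ck_comp2 oW SW CTheta (le1 _ Cnk) (le1 _ CTk).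
have Cc : Ck 1 W (fun x => c_inf F (Tl x)) := Ck_c_inf Tc0 oW (le1 _ CTl) TlW.
have Cuk1 i : Ck 1 W (fun x => uk x ord0 i) := Ck_S (Cuk i).
have dt0' : dt != 0 by rewrite gt_eqF.
have M0' : Mweight F != 0 by rewrite gt_eqF.
have nk0 x : W x -> nk x != 0 by move=> /nkW /andP[h _]; rewrite gt_eqF.
pose V := energy_flux dt (Mweight F) nk nl1 mu_l1 s_k Tl Tl1 eta_k lambda_k Theta_k
  (fun x => c_inf F (Tl x)) uk ul1.
have CV i : Ck 1 W (V i).
  exact: (Ck_energy_flux dt oW M0' nk0 Cmu (le1 _ Cnk) (le2 _ Cnl1) (le2 _ CTl) (le2 _ CTl1)
    Cs Ceta_k Clam_k CTh_k Cc Cuk1 Cu1 i).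
have GG i := gauss_green_domain dO ssig onu i oW OW (CV i).
have Eus' x : Omega x -> forall i, us x ord0 i =
    ustar dt (Mweight F) nk mu_l1 s_k Tl uk i x.
  by move=> Ox i; rewrite Eus// !mxE.
have sgam x : gamma_k x = - s_k x by rewrite /s_k /entropy_at /entropy opprK.
have EB x (Ox : Omega x) := energy_balance oO oW OsubW dt0' M0' nk0 Cmu (le1 _ Cnk)
  (le2 _ Cnl1) (le2 _ CTl) (le2 _ CTl1) Cs Ceta_k Clam_k CTh_k Cc Cuk1 Cu1 sgam Eus'
  Emass Emom Eenergy Ox.
have mO : measurable Omega by exact: open_measurable_rV.
have mb := @measurable_boundary R n Omega.
have GG1 i : (lebesgue_rV n.+1).-integrable Omega (EFin \o partial i (V i)) by case: (GG i).
have GG2 i : sigma.-integrable (boundary Omega) (EFin \o (fun x => V i x * nu x ord0 i)).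
  by case: (GG i).
have [iV eV] := Rintegral_sum mO GG1.
have [iS eS] := Rintegral_sum mb GG2.
have C0sq (u : 'rV[R]_n.+1 -> 'rV[R]_n.+1) f : (forall i, Ck 2 W (fun x => u x ord0 i)) ->
    Ck 4 W f -> Ck 0 W (fun x => mass_density F f x * sqn (u x)).
  move=> Cu Cf; apply: (Ck_M oW (Ck_M oW (Ck_le (leq0n 4) Cf) (Ck_cst 0 W (Mweight F)))).
  by apply: (Ck_sqn oW) => i; exact: (Ck_le (leq0n 2) (Cu i)).
have ia1 := integrable_domain dO oW OW (C0sq _ _ Cu1 Cnl1).
have iak := integrable_domain dO oW OW (C0sq _ _ Cuk Cnk).
have itk := integrable_domain dO oW OW
  (Ck_internal_energy_at R0 Tc0 Pc0 oW (le1 _ Cnk) (le1 _ CTk) nkW TkW).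
rewrite -/rho_l1 in ia1; rewrite -/rho_k in iak; rewrite -/theta_k in itk.
pose a1 x := rho_l1 x * sqn (ul1 x); pose ak x := rho_k x * sqn (uk x).
pose dV x := \sum_i partial i (V i) x.
(* The balance law solved for [theta_l1]: every term on the right is integrable, so the integral of
   [theta_l1] follows without studying the temperature derivative in its linearization. *)
have Et1 : {in Omega, theta_l1 =1 (fun x => dt * dV x + theta_k x + 2^-1 * (ak x - a1 x))}.
  move=> x /set_mem Ox; rewrite /dV -(EB x Ox) /ak /a1 /rho_k /rho_l1 /mass_density.
  by field.
have i1 : (lebesgue_rV n.+1).-integrable Omega (EFin \o (fun x => dt * dV x)).
  exact: Rintegrable_scale.
have i2 : (lebesgue_rV n.+1).-integrable Omega (EFin \o (fun x => ak x - a1 x)).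
  exact: (integrableB mO iak ia1).
have i3 : (lebesgue_rV n.+1).-integrable Omega (EFin \o (fun x => 2^-1 * (ak x - a1 x))).
  exact: Rintegrable_scale.
have i4 : (lebesgue_rV n.+1).-integrable Omega (EFin \o (fun x => dt * dV x + theta_k x)).
  exact: (integrableD mO i1 itk).
have ET1 : \int[lebesgue_rV n.+1]_(x in Omega) theta_l1 x =
    dt * \int[lebesgue_rV n.+1]_(x in Omega) dV x
    + \int[lebesgue_rV n.+1]_(x in Omega) theta_k x
    + 2^-1 * (\int[lebesgue_rV n.+1]_(x in Omega) ak x -
              \int[lebesgue_rV n.+1]_(x in Omega) a1 x).
  rewrite (eq_Rintegral _ Et1) (RintegralD mO i4 i3) (RintegralD mO i1 itk).
  by rewrite (RintegralZl _ mO iV) (RintegralZl _ mO i2) (RintegralB mO iak ia1).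
rewrite /total_energy ET1 -/ak -/a1.
(* The kinetic integrals cancel and only the divergence of the flux remains. *)
transitivity (\int[lebesgue_rV n.+1]_(x in Omega) dV x); first by field.
rewrite eV; under eq_bigr => i _ do rewrite (let: And3 _ _ h := GG i in h).
rewrite -eS.
have EqS : {in boundary Omega, (fun x => dot (q x) (nu x)) =1
    (fun x => -1 * \sum_i V i x * nu x ord0 i)}.
  move=> x /set_mem bx; have [uk0 u10 _] := bu x bx.
  have [_ _ n10] := bn x bx; have Gn := bmu x bx.
  (* With [uk] and [ul1] zero, [ustar] is -dt / (nk M) times the gradient terms. The flux is then
     the conduction term, plus a multiple of those gradient terms with factor [K], plus [C] times
     grad nl1; the last two have no normal component. *)
  pose K := mu_l1 x * nk x + s_k x * Tl x.
  pose C := (nl1 x - nk x) / dt * c_inf F (Tl x).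
  have hV i : V i x * nu x ord0 i = Theta_k x * (grad Tl1 x ord0 i * nu x ord0 i)
      + K * (dt / (nk x * Mweight F)) * ((nk x *: grad mu_l1 x + s_k x *: grad Tl x) ord0 i * nu x ord0 i)
      + C * (grad nl1 x ord0 i * nu x ord0 i).
    rewrite /V /energy_flux /ustar uk0 u10 big1; last by move=> k _; rewrite !mxE mulr0.
    have -> : sqn (0 : 'rV[R]_n.+1) = 0 by rewrite /sqn /dot big1// => k _; rewrite mxE mul0r.
    by rewrite /K /C !mxE; ring.
  under [in RHS]eq_bigr do rewrite hV.
  rewrite !big_split/= -!mulr_sumr.
  rewrite /dot in Gn n10; rewrite Gn n10 !mulr0 !addr0.
  rewrite mulN1r mulr_sumr -sumrN; apply: eq_bigr => i _.
  by rewrite /q !mxE mulNr mulrA.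
by rewrite (eq_Rintegral _ EqS) (RintegralZl _ mb iS) mulN1r opprK.
Qed.
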